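(* Let $\Phi$ be a $\operatorname{Spin}(7)$-structure on a smooth $8$-manifold $M$ with associated metric $g$. Let $\beta_{ij}$ be a $2$-form and $\gamma_{ijk}$ a $3$-form. Then $$\beta\in\Omega^2_7\iff \beta_{ab}g^{ap}g^{bq}\Phi_{pqij}=-6\,\beta_{ij},\qquad \beta\in\Omega^2_{21}\iff\beta_{ab}g^{ap}g^{bq}\Phi_{pqij}=2\,\beta_{ij},$$ $$\gamma\in\Omega^3_8\iff\gamma_{ijk}=X^l\Phi_{ijkl}\ \text{for some vector field } X,\qquad \gamma\in\Omega^3_{48}\iff\gamma_{ijk}g^{ia}g^{jb}g^{kc}\Phi_{abcd}=0,$$ and the projection operators $\pi_7$ and $\pi_{21}$ of $\Omega^2$ onto $\Omega^2_7$ and $\Omega^2_{21}$ are given by $$\pi_7(\beta)_{ij}=\frac14\beta_{ij}-\frac18\beta_{ab}g^{ap}g^{bq}\Phi_{pqij},\qquad \pi_{21}(\beta)_{ij}=\frac34\beta_{ij}+\frac18\beta_{ab}g^{ap}g^{bq}\Phi_{pqij}.$$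
   Context: A $\operatorname{Spin}(7)$-structure on a smooth $8$-manifold $M$ (not necessarily compact) is a smooth $4$-form $\Phi$ such that at each point there is a basis $e^1,\dots,e^8$ of the cotangent space in which $\Phi = -\big(e^{1234}+e^{1256}+e^{1278}+e^{3456}+e^{3478}+e^{5678}+e^{1357}-e^{1368}-e^{1458}-e^{1467}-e^{2358}-e^{2367}-e^{2457}+e^{2468}\big)$, where $e^{ijkl}=e^i\wedge e^j\wedge e^k\wedge e^l$. It determines a Riemannian metric $g=g_\Phi$ and an orientation, for which such a basis is oriented orthonormal; then $\ast\Phi=\Phi$. In local coordinates $\Phi=\frac1{24}\Phi_{ijkl}dx^i\wedge dx^j\wedge dx^k\wedge dx^l$, $\beta=\frac12\beta_{ij}dx^i\wedge dx^j$, $\gamma=\frac16\gamma_{ijk}dx^i\wedge dx^j\wedge dx^k$, and repeated indices are summed. The orthogonal decompositions $\Omega^2=\Omega^2_7\oplus\Omega^2_{21}$ and $\Omega^3=\Omega^3_8\oplus\Omega^3_{48}$ are given by $\Omega^2_7=\{\beta: \ast(\Phi\wedge\beta)=-3\beta\}$, $\Omega^2_{21}=\{\beta:\ast(\Phi\wedge\beta)=\beta\}$, $\Omega^3_8=\{X\lrcorner\Phi: X\in\Gamma(TM)\}$, $\Omega^3_{48}=\{\gamma:\gamma\wedge\Phi=0\}$, where $\lrcorner$ is interior product. *)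

(* Defs.v *)
Set Warnings "-notation-incompatible-prefix,-notation-overridden".
From HB Require Import structures.
From mathcomp Require Export all_boot all_order all_algebra perm.
From mathcomp Require Export all_classical all_reals all_analysis.
Set Implicit Arguments.
Unset Strict Implicit.
Unset Printing Implicit Defensive.
Export Order.TTheory GRing.Theory Num.Theory numFieldNormedType.Exports.

#[global] Open Scope classical_set_scope.
#[global] Open Scope ring_scope.

(* Smooth manifolds are given by an atlas, and tensor fields by their
   components in each chart of the atlas, subject to the classical
   transformation law. Components of a field at a point [p] in a chart [c]
   carry meaning only when [c] belongs to the atlas and [p] to the domain of
   [c]; all statements are restricted to such pairs by [in_coords]. *)

(** * Smooth functions on open subsets of R^n *)

Definition partial (R : realType) n (i : 'I_n) (f : 'rV[R]_n -> R) :
  'rV[R]_n -> R := fun x => 'D_(delta_mx 0 i) f x.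

(* All partial derivatives of order at most [k] exist and are continuous. *)
Fixpoint Ck_on (R : realType) n (k : nat) (U : set 'rV[R]_n)
    (f : 'rV[R]_n -> R) : Prop :=
  (forall x, U x -> {for x, continuous f}) /\
  (if k is k'.+1 then
     forall i : 'I_n, (forall x, U x -> derivable f x (delta_mx 0 i)) /\
                      Ck_on k' U (partial i f)
   else True).

Definition smooth_on (R : realType) n (U : set 'rV[R]_n)
    (f : 'rV[R]_n -> R) : Prop := forall k, Ck_on k U f.

(** * Smooth manifolds *)

(* [coord] and [param] are total functions, meaningful on [dom] and
   [coord @` dom], between which they are inverse homeomorphisms. *)
Record chart (R : realType) (n : nat) (M : topologicalType) := Chart {
  dom : set M;
  coord : M -> 'rV[R]_n;
  param : 'rV[R]_n -> M;
  dom_open : open dom;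
  img_open : open (coord @` dom);
  coordK : forall p, dom p -> param (coord p) = p;
  coord_cont : forall p, dom p -> {for p, continuous coord};
  param_cont : forall x, (coord @` dom) x -> {for x, continuous param} }.

Definition transition (R : realType) n (M : topologicalType)
    (c c' : chart R n M) : 'rV[R]_n -> 'rV[R]_n :=
  fun x => coord c' (param c x).

Record manifold (R : realType) (n : nat) := Manifold {
  points :> topologicalType;
  atlas : set (chart R n points);
  manifold_hausdorff : hausdorff_space points;
  manifold_second_countable : @second_countable points;
  atlas_cover : forall p : points, exists2 c, atlas c & dom c p;
  atlas_compat : forall c c', atlas c -> atlas c' -> forall i : 'I_n,
    smooth_on (coord c @` (dom c `&` dom c'))
              (fun x => transition c c' x 0 i) }.

Definition in_coords (R : realType) n (M : manifold R n)
    (P : chart R n M -> M -> Prop) : Prop :=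
  forall c p, atlas c -> dom c p -> P c p.

(* Row [a], column [i] holds dy^a/dx^i at [p], where x and y are the
   coordinates of [c] and [c']. *)
Definition jac (R : realType) n (M : topologicalType) (c c' : chart R n M)
    (p : M) : 'M[R]_n :=
  \matrix_(a, i) partial i (fun x => transition c c' x 0 a) (coord c p).

(** * Tensor fields and differential forms *)

(* Components T_{i1...ik} of a covariant k-tensor at a point. *)
Definition comps (R : realType) (n k : nat) := k.-tuple 'I_n -> R.

Record tensor_field (R : realType) n (M : manifold R n) (k : nat) :=
  TensorField {
  tcomp :> chart R n M -> M -> comps R n k;
  tcomp_smooth : forall c, atlas c -> forall I : k.-tuple 'I_n,
    smooth_on (coord c @` dom c) (fun x => tcomp c (param c x) I);
  tcomp_transf : forall c c' p, atlas c -> atlas c' -> dom c p -> dom c' p ->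
    forall I : k.-tuple 'I_n,
    tcomp c p I = \sum_(A : k.-tuple 'I_n) tcomp c' p A *
                    \prod_(r < k) jac c c' p (tnth A r) (tnth I r) }.

Definition alternating (R : realType) n k (a : comps R n k) : Prop :=
  forall (s : 'S_k) (I : k.-tuple 'I_n),
    a [tuple tnth I (s r) | r < k] = (-1) ^+ s * a I.

(* With w_{i1...ik} the components, w = (1/k!) w_{i1...ik} dx^{i1}...dx^{ik}. *)
Record form (R : realType) n (M : manifold R n) (k : nat) := Form {
  form_tensor :> tensor_field M k;
  form_alt : in_coords (fun c p => alternating (form_tensor c p)) }.

Record vector_field (R : realType) n (M : manifold R n) := VectorField {
  vcomp :> chart R n M -> M -> 'I_n -> R;
  vcomp_smooth : forall c, atlas c -> forall i,
    smooth_on (coord c @` dom c) (fun x => vcomp c (param c x) i);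
  vcomp_transf : forall c c' p, atlas c -> atlas c' -> dom c p -> dom c' p ->
    forall a, vcomp c' p a = \sum_(i < n) jac c c' p a i * vcomp c p i }.

Definition gram (R : realType) n (t : comps R n 2) : 'M[R]_n :=
  \matrix_(i, j) t [tuple i; j].

Record metric (R : realType) n (M : manifold R n) := Metric {
  metric_tensor :> tensor_field M 2;
  metric_sym : in_coords (fun c p =>
    (gram (metric_tensor c p))^T = gram (metric_tensor c p));
  metric_posdef : in_coords (fun c p => forall v : 'rV[R]_n, v != 0 ->
    0 < (v *m gram (metric_tensor c p) *m v^T) 0 0) }.

(* g^{ij} *)
Definition ginv (R : realType) n (M : manifold R n) (g : metric M)
    (c : chart R n M) (p : M) : 'M[R]_n := invmx (gram (g c p)).

(* The value at [c], [p] is 1 if dx^1,...,dx^n is positively oriented at [p],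
   and -1 otherwise. *)
Record orientation (R : realType) n (M : manifold R n) := Orientation {
  osign :> chart R n M -> M -> R;
  osign_pm1 : in_coords (fun c p => osign c p = 1 \/ osign c p = -1);
  osign_locally_constant :
    in_coords (fun c p => \forall q \near p, osign c q = osign c p);
  osign_transf : forall c c' p, atlas c -> atlas c' -> dom c p -> dom c' p ->
    osign c' p = Num.sg (\det (jac c c' p)) * osign c p }.

(** * Pointwise exterior algebra in components *)

(* (a /\ b)_{I} = 1/(k! l!) sum_s sgn(s) a_{I s(1..k)} b_{I s(k+1..k+l)},
   so that dx /\ dy has (dx, dy)-component 1. *)
Definition wedge (R : realType) n k l (a : comps R n k) (b : comps R n l) :
    comps R n (k + l) := fun I =>
  (k`! * l`!)%:R^-1 *
  \sum_(s : 'S_(k + l)) (-1) ^+ s *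
     a [tuple tnth I (s (lshift l r)) | r < k] *
     b [tuple tnth I (s (rshift k r)) | r < l].

(* (X _| w)_{i2...ik} = X^i w_{i i2...ik} *)
Definition interior (R : realType) n k (X : 'I_n -> R) (w : comps R n k.+1) :
    comps R n k := fun I => \sum_(i < n) X i * w [tuple of i :: I].

(* Volume form of the metric with matrix [G], for the orientation sign [o]:
   the determinant is the Levi-Civita symbol of [I]. *)
Definition volume (R : realType) n (G : 'M[R]_n) (o : R) : comps R n n :=
  fun I => o * Num.sqrt (\det G) *
           \det (\matrix_(r < n, s < n) (tnth I r == s)%:R).

(* ( *a )_{J} = 1/k! a_{I} g^{i1 a1} ... g^{ik ak} vol_{a1...ak J}, that is
   b /\ *a = <b, a> vol. *)
Definition hodge (R : realType) k m (G : 'M[R]_(k + m)) (o : R)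
    (a : comps R (k + m) k) : comps R (k + m) m := fun J =>
  (k`!)%:R^-1 *
  \sum_(I : k.-tuple 'I_(k + m)) \sum_(A : k.-tuple 'I_(k + m))
     a I * (\prod_(r < k) invmx G (tnth I r) (tnth A r)) *
     volume G o [tuple of A ++ J].

(** * Spin(7)-structures *)

(* A basis e^1,...,e^8 of the cotangent space is encoded by the invertible
   matrix [E] with e^{a+1} = E_{a i} dx^i; [coframe1 E a] is e^a, with [a]
   ranging over 1..8. *)
Definition coframe1 (R : realType) (E : 'M[R]_8) (a : nat) : comps R 8 1 :=
  fun I => E (inord a.-1) (tnth I ord0).

Definition coframe4 (R : realType) (E : 'M[R]_8) (i j k l : nat) :
    comps R 8 4 :=
  wedge (coframe1 E i)
    (wedge (coframe1 E j) (wedge (coframe1 E k) (coframe1 E l))).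

Definition standard_form (R : realType) (E : 'M[R]_8) : comps R 8 4 :=
  fun I =>
  - (coframe4 E 1 2 3 4 I + coframe4 E 1 2 5 6 I
     + coframe4 E 1 2 7 8 I + coframe4 E 3 4 5 6 I
     + coframe4 E 3 4 7 8 I + coframe4 E 5 6 7 8 I
     + coframe4 E 1 3 5 7 I - coframe4 E 1 3 6 8 I
     - coframe4 E 1 4 5 8 I - coframe4 E 1 4 6 7 I
     - coframe4 E 2 3 5 8 I - coframe4 E 2 3 6 7 I
     - coframe4 E 2 4 5 7 I + coframe4 E 2 4 6 8 I).

Definition adapted_coframe (R : realType) (M : manifold R 8) (Phi : form M 4)
    (c : chart R 8 M) (p : M) (E : 'M[R]_8) : Prop :=
  E \in unitmx /\ forall I, Phi c p I = standard_form E I.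

Definition Spin7_structure (R : realType) (M : manifold R 8)
    (Phi : form M 4) : Prop :=
  in_coords (fun c p => exists E, adapted_coframe Phi c p E).

(* Adapted coframes are orthonormal, i.e. g = sum_a e^a (x) e^a. *)
Definition associated_metric (R : realType) (M : manifold R 8)
    (Phi : form M 4) (g : metric M) : Prop :=
  in_coords (fun c p => forall E, adapted_coframe Phi c p E ->
    gram (g c p) = E^T *m E).

(* e^1 /\ ... /\ e^8 = det E dx^1 /\ ... /\ dx^8 is positive. *)
Definition associated_orientation (R : realType) (M : manifold R 8)
    (Phi : form M 4) (o : orientation M) : Prop :=
  in_coords (fun c p => forall E, adapted_coframe Phi c p E ->
    0 < o c p * \det E).

Section Decompositions.
Variables (R : realType) (M : manifold R 8).
Variables (Phi : form M 4) (g : metric M) (o : orientation M).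

Definition star_Phi_wedge (b : form M 2) (c : chart R 8 M) (p : M) :
    comps R 8 2 :=
  @hodge R 6 2 (gram (g c p)) (o c p) (wedge (Phi c p) (b c p)).

Definition Omega2_7 : set (form M 2) :=
  [set b | in_coords (fun c p => forall I,
     star_Phi_wedge b c p I = - 3 * b c p I)].

Definition Omega2_21 : set (form M 2) :=
  [set b | in_coords (fun c p => forall I,
     star_Phi_wedge b c p I = b c p I)].

Definition Omega3_8 : set (form M 3) :=
  [set w | exists X : vector_field M, in_coords (fun c p => forall I,
     w c p I = interior (X c p) (Phi c p) I)].

Definition Omega3_48 : set (form M 3) :=
  [set w | in_coords (fun c p => forall I, wedge (w c p) (Phi c p) I = 0)].

(* beta_{ab} g^{ap} g^{bq} Phi_{pqij} *)
Definition contract2 (b : form M 2) (c : chart R 8 M) (p : M) (i j : 'I_8) :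
    R :=
  \sum_(a < 8) \sum_(a' < 8) \sum_(q < 8) \sum_(q' < 8)
    b c p [tuple a; a'] * ginv g c p a q * ginv g c p a' q' *
    Phi c p [tuple q; q'; i; j].

(* gamma_{ijk} g^{ia} g^{jb} g^{kc} Phi_{abcd} *)
Definition contract3 (w : form M 3) (c : chart R 8 M) (p : M) (d : 'I_8) : R :=
  \sum_(i < 8) \sum_(j < 8) \sum_(k < 8)
  \sum_(a < 8) \sum_(a' < 8) \sum_(a'' < 8)
    w c p [tuple i; j; k] *
    ginv g c p i a * ginv g c p j a' * ginv g c p k a'' *
    Phi c p [tuple a; a'; a''; d].

End Decompositions.

Definition is_sum (R : realType) n (M : manifold R n) k (w u v : form M k) :
    Prop := in_coords (fun c p => forall I, w c p I = u c p I + v c p I).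

Definition same_form (R : realType) n (M : manifold R n) k (u v : form M k) :
    Prop := in_coords (fun c p => forall I, u c p I = v c p I).

(* [pA] and [pB] are the projections onto the summands of the direct sum
   decomposition of the space of k-forms into [A] and [B]. *)
Definition decomposition_projections (R : realType) n (M : manifold R n) k
    (A B : set (form M k)) (pA pB : form M k -> form M k) : Prop :=
  forall w, [/\ A (pA w), B (pB w), is_sum w (pA w) (pB w) &
    forall u v, A u -> B v -> is_sum w u v ->
      same_form u (pA w) /\ same_form v (pB w)].

(* Main.v *)
Require Import Defs.
From mathcomp Require Import ring lra.
Set Implicit Arguments.
Unset Strict Implicit.
Unset Printing Implicit Defensive.

(* Every operation in the statement commutes with pulling components back along
   a matrix, so at each point an adapted coframe [E] reduces the claims to the
   flat model form phi on R^8, whose metric is the identity. There they follow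
   from two finite identities: phi is self-dual, and
   phi_{ijab} phi_{abkl} = - 4 phi_{ijkl} + 6 (d_ik d_jl - d_il d_jk).
   By self-duality, *(Phi /\ b) is half of the contraction K b of b with Phi,
   and w /\ Phi is dual to the contraction of w with Phi, up to a nonzero
   constant. The second identity says K^2 + 4 K - 12 = 0 on 2-forms, hence the
   eigenvalues -6 and 2 and the projections 1/4 - K/8 and 3/4 + K/8. These
   preserve smooth forms because the inverse metric is smooth and
   contraction is natural under changes of coordinates. *)

(** * Smooth functions *)

Section SmoothFunctions.
Variables (R : realType) (n : nat).
Implicit Types (f g : 'rV[R]_n -> R) (U : set 'rV[R]_n).

Lemma Ck_onW k U f : Ck_on k.+1 U f -> Ck_on k U f.
Proof.
elim: k f => [|k IH] f /= [fc fd]; first by split.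
by split=> // i; have [di /IH] := fd i.
Qed.

Lemma near_eq_continuous_at f g x : (\forall y \near x, f y = g y) ->
  {for x, continuous f} -> {for x, continuous g}.
Proof.
move=> fg; rewrite /prop_for /continuous_at -(nbhs_singleton fg).
by apply: cvg_trans; apply: (@near_eq_cvg _ _ (nbhs x)).
Qed.

(** Continuity and derivatives at a point depend only on nearby values, and on an open set equality
    at all points is equality near each of them. *)
Lemma eq_Ck_on k U f g : open U -> (forall x, U x -> f x = g x) ->
  Ck_on k U f -> Ck_on k U g.
Proof.
move=> Uo; elim: k f g => [|k IH] f g fg [fc fd].
all: have nfg x : U x -> \forall y \near x, f y = g y
  by move=> Ux; apply: filterS (open_nbhs_nbhs (conj Uo Ux)) => y /fg.
  by split=> // x Ux; exact: near_eq_continuous_at (nfg x Ux) (fc x Ux).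
split; first by move=> x Ux; exact: near_eq_continuous_at (nfg x Ux) (fc x Ux).
move=> i.
have [di ci] := fd i; split.
  by move=> x Ux; apply: (near_eq_derivable (nfg x Ux)); exact: di.
apply: (IH _ _ _ ci) => x Ux; exact: near_eq_derive (nfg x Ux).
Qed.

Lemma Ck_on_cst k U a : open U -> Ck_on k U (fun=> a).
Proof.
move=> Uo; elim: k a => [|k IH] a; split=> //; [| |move=> i].
- by move=> x _; exact: cst_continuous.
- by move=> x _; exact: cst_continuous.
split=> [x _|]; first exact: derivable_cst.
by apply: eq_Ck_on (IH 0) => // x Ux; rewrite /partial derive_cst.
Qed.

Lemma Ck_onD k U f g : open U -> Ck_on k U f -> Ck_on k U g ->
  Ck_on k U (fun x => f x + g x).
Proof.
move=> Uo; elim: k f g => [|k IH] f g [fc fd] [gc gd]; split=> //.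
- by move=> x Ux; apply: continuousD; [exact: fc|exact: gc].
- by move=> x Ux; apply: continuousD; [exact: fc|exact: gc].
move=> i; have [fi fci] := fd i; have [gi gci] := gd i; split.
  by move=> x Ux; apply: derivableD; [exact: fi|exact: gi].
apply: eq_Ck_on (IH _ _ fci gci) => // x Ux.
by rewrite /partial [RHS]deriveD; [|exact: fi|exact: gi].
Qed.

Lemma Ck_onM k U f g : open U -> Ck_on k U f -> Ck_on k U g ->
  Ck_on k U (fun x => f x * g x).
Proof.
move=> Uo; elim: k f g => [|k IH] f g fk gk.
  by split=> // x Ux; apply: continuousM; [exact: fk.1|exact: gk.1].
(* The product rule yields [f] times a derivative of [g] and conversely. The induction hypothesis
   applies to these once the undifferentiated factors are known at order [k]. *)
have fk' := Ck_onW fk; have gk' := Ck_onW gk.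
case: fk gk => [fc fd] [gc gd]; split.
  by move=> x Ux; apply: continuousM; [exact: fc|exact: gc].
move=> i; have [fi fci] := fd i; have [gi gci] := gd i; split.
  by move=> x Ux; apply: derivableM; [exact: fi|exact: gi].
have := Ck_onD Uo (IH _ _ fk' gci) (IH _ _ gk' fci).
apply: eq_Ck_on => // x Ux.
by rewrite /partial [RHS]deriveM; [|exact: fi|exact: gi].
Qed.

Lemma Ck_onV k U f : open U -> (forall x, U x -> f x != 0) -> Ck_on k U f ->
  Ck_on k U (fun x => (f x)^-1).
Proof.
move=> Uo f0; elim: k => [|k IH] fk.
  by split=> // x Ux; apply: continuousV; [exact: f0|exact: fk.1].
have fk' := IH (Ck_onW fk); case: fk => [fc fd]; split.
  by move=> x Ux; apply: continuousV; [exact: f0|exact: fc].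
move=> i; have [fi fci] := fd i; split.
  by move=> x Ux; apply: derivableV; [exact: f0|exact: fi].
(* The derivative of [f^-1] is [- f^-1 * f^-1] times that of [f], and [f^-1] itself has order [k] by
   induction. *)
have := Ck_onM Uo (Ck_onM Uo (Ck_on_cst k (-1) Uo) (Ck_onM Uo fk' fk')) fci.
apply: eq_Ck_on => // x Ux.
rewrite /partial [RHS]deriveV; [|exact: f0|exact: fi].
by rewrite /GRing.scale /= mulN1r -expr2 exprVn.
Qed.

Lemma eq_smooth_on U f g : open U -> (forall x, U x -> f x = g x) ->
  smooth_on U f -> smooth_on U g.
Proof. by move=> Uo fg fs k; exact: eq_Ck_on (fs k). Qed.

Lemma smooth_on_cst U a : open U -> smooth_on U (fun=> a).
Proof. by move=> Uo k; exact: Ck_on_cst. Qed.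

Lemma smooth_onD U f g : open U -> smooth_on U f -> smooth_on U g ->
  smooth_on U (fun x => f x + g x).
Proof. by move=> Uo fs gs k; exact: Ck_onD. Qed.

Lemma smooth_onM U f g : open U -> smooth_on U f -> smooth_on U g ->
  smooth_on U (fun x => f x * g x).
Proof. by move=> Uo fs gs k; exact: Ck_onM. Qed.

Lemma smooth_onZ U a f : open U -> smooth_on U f ->
  smooth_on U (fun x => a * f x).
Proof. by move=> Uo; apply: smooth_onM => //; exact: smooth_on_cst. Qed.

Lemma smooth_onV U f : open U -> (forall x, U x -> f x != 0) ->
  smooth_on U f -> smooth_on U (fun x => (f x)^-1).
Proof. by move=> Uo f0 fs k; exact: Ck_onV. Qed.

Lemma smooth_on_sum (I : Type) (r : seq I) (P : pred I) U
    (F : I -> 'rV[R]_n -> R) : open U -> (forall i, smooth_on U (F i)) ->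
  smooth_on U (fun x => \sum_(i <- r | P i) F i x).
Proof.
move=> Uo Fs; elim: r => [|i r IH].
  by apply: (@eq_smooth_on _ (fun=> 0)) => // [x _|];
    [rewrite big_nil|exact: smooth_on_cst].
case Pi: (P i); last by apply: eq_smooth_on IH => // x _; rewrite big_cons Pi.
by apply: eq_smooth_on (smooth_onD Uo (Fs i) IH) => // x _; rewrite big_cons Pi.
Qed.

Lemma smooth_on_prod (I : Type) (r : seq I) (P : pred I) U
    (F : I -> 'rV[R]_n -> R) : open U -> (forall i, smooth_on U (F i)) ->
  smooth_on U (fun x => \prod_(i <- r | P i) F i x).
Proof.
move=> Uo Fs; elim: r => [|i r IH].
  by apply: (@eq_smooth_on _ (fun=> 1)) => // [x _|];
    [rewrite big_nil|exact: smooth_on_cst].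
case Pi: (P i); last by apply: eq_smooth_on IH => // x _; rewrite big_cons Pi.
by apply: eq_smooth_on (smooth_onM Uo (Fs i) IH) => // x _; rewrite big_cons Pi.
Qed.

Lemma smooth_on_det m U (A : 'rV[R]_n -> 'M[R]_m) : open U ->
  (forall i j, smooth_on U (fun x => A x i j)) ->
  smooth_on U (fun x => \det (A x)).
Proof.
move=> Uo As; apply: smooth_on_sum => // s; apply: smooth_onZ => //.
exact: smooth_on_prod.
Qed.

(** Cramer's rule: each entry is a cofactor divided by the determinant, and both are polynomial in
    the entries of [A x]. *)
Lemma smooth_on_invmx m U (A : 'rV[R]_n -> 'M[R]_m) : open U ->
  (forall x, U x -> A x \in unitmx) ->
  (forall i j, smooth_on U (fun x => A x i j)) ->
  forall i j, smooth_on U (fun x => invmx (A x) i j).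
Proof.
move=> Uo Au As i j.
apply: (@eq_smooth_on _ (fun x => (\det (A x))^-1 * cofactor (A x) j i)) => //.
  by move=> x Ux; rewrite /invmx Au // !mxE.
apply: smooth_onM => //.
  apply: smooth_onV => // [x Ux|]; last exact: smooth_on_det.
  by rewrite -unitfE -unitmxE Au.
apply: smooth_onZ => //; apply: smooth_on_det => // k l.
by apply: eq_smooth_on (As (lift j k) (lift i l)) => // x _; rewrite !mxE.
Qed.

End SmoothFunctions.

(** * Pullback and contraction of components *)

Section TupleSums.

Definition permute k T (s : 'S_k) (I : k.-tuple T) : k.-tuple T :=
  [tuple tnth I (s r) | r < k].

Lemma tnth_permute k T (s : 'S_k) (I : k.-tuple T) r :
  tnth (permute s I) r = tnth I (s r).
Proof. by rewrite tnth_mktuple. Qed.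

Lemma permuteM k T (s t : 'S_k) (I : k.-tuple T) :
  permute s (permute t I) = permute (s * t)%g I.
Proof. by apply: eq_from_tnth => r; rewrite !tnth_permute permM. Qed.

Lemma permute1 k T (I : k.-tuple T) : permute 1%g I = I.
Proof. by apply: eq_from_tnth => r; rewrite tnth_permute perm1. Qed.

Lemma permuteK k T (s : 'S_k) :
  cancel (@permute k T s) (@permute k T (s^-1)%g).
Proof. by move=> I; rewrite permuteM mulVg permute1. Qed.

Lemma permuteKV k T (s : 'S_k) :
  cancel (@permute k T (s^-1)%g) (@permute k T s).
Proof. by move=> I; rewrite permuteM mulgV permute1. Qed.

(** Reindexing a sum over tuples by [s^-1] undoes the shuffle in [wedge]: the arguments of the two
    factors become the plain blocks [A] and, in the next lemma, [B]. *)
Lemma permuteV_lshift k l T (s : 'S_(k + l)) (A : k.-tuple T)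
    (B : l.-tuple T) :
  [tuple tnth (permute (s^-1)%g [tuple of A ++ B]) (s (lshift l r)) | r < k]
  = A.
Proof.
apply: eq_from_tnth => r.
by rewrite tnth_mktuple tnth_permute permK tnth_lshift.
Qed.

Lemma permuteV_rshift k l T (s : 'S_(k + l)) (A : k.-tuple T)
    (B : l.-tuple T) :
  [tuple tnth (permute (s^-1)%g [tuple of A ++ B]) (s (rshift k r)) | r < l]
  = B.
Proof.
apply: eq_from_tnth => r.
by rewrite tnth_mktuple tnth_permute permK tnth_rshift.
Qed.

Variables (R : comPzRingType) (T : finType).

Lemma sum_permute k (s : 'S_k) (F : k.-tuple T -> R) :
  \sum_I F I = \sum_I F (permute s I).
Proof. by apply: reindex_inj; exact: can_inj (permuteK s). Qed.

Lemma prod_sum_tnth k (F : 'I_k -> T -> R) :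
  \prod_(r < k) \sum_(x : T) F r x =
  \sum_(A : k.-tuple T) \prod_(r < k) F r (tnth A r).
Proof.
rewrite bigA_distr_bigA (reindex (fun A : k.-tuple T => [ffun r => tnth A r])).
  by apply: eq_bigr => A _; apply: eq_bigr => r _; rewrite ffunE.
exists (fun f : {ffun 'I_k -> T} => [tuple f r | r < k]) => [A _|f _].
  by apply: eq_from_tnth => r; rewrite tnth_mktuple ffunE.
by apply/ffunP => r; rewrite ffunE tnth_mktuple.
Qed.

Lemma sum_tuple_cat k l (F : (k + l).-tuple T -> R) :
  \sum_C F C = \sum_(A : k.-tuple T) \sum_(B : l.-tuple T) F [tuple of A ++ B].
Proof.
rewrite pair_big /= (reindex (fun p : k.-tuple T * l.-tuple T =>
  [tuple of p.1 ++ p.2])) //.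
exists (fun C : (k + l).-tuple T =>
  ([tuple tnth C (lshift l r) | r < k], [tuple tnth C (rshift k r) | r < l])).
  move=> [A B] _; congr (_, _); apply: eq_from_tnth => r;
  by rewrite tnth_mktuple ?tnth_lshift ?tnth_rshift.
move=> C _; apply: eq_from_tnth => r.
by case: (split_ordP r) => j ->; rewrite ?tnth_lshift ?tnth_rshift tnth_mktuple.
Qed.

Lemma sum_tuple1 (F : 1.-tuple T -> R) : \sum_A F A = \sum_x F [tuple x].
Proof.
rewrite (reindex (fun x => [tuple x])) //.
exists (@thead 0 T) => // A _; apply: eq_from_tnth => r.
by rewrite ord1.
Qed.

Lemma sum_tuple_cons k (F : k.+1.-tuple T -> R) :
  \sum_A F A = \sum_x \sum_(A : k.-tuple T) F [tuple of x :: A].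
Proof.
rewrite (@sum_tuple_cat 1 k) sum_tuple1; apply: eq_bigr => x _.
by apply: eq_bigr => A _; congr F; apply: val_inj.
Qed.

End TupleSums.

(** The pullback of a covariant tensor along the linear map with matrix [E]. The transformation law
    of tensor fields is the case of a Jacobian. *)
Definition pull (R : realType) n (E : 'M[R]_n) k (a : comps R n k) :
    comps R n k :=
  fun I => \sum_(A : k.-tuple 'I_n) a A * \prod_(r < k) E (tnth A r) (tnth I r).

(* a_I g^{i1 a1} ... g^{ik ak} b_{a1...ak J}, with the inverse of [G]. *)
Definition contract (R : realType) n k m (G : 'M[R]_n)
    (a : comps R n k) (b : comps R n (k + m)) : comps R n m :=
  fun J => \sum_(I : k.-tuple 'I_n) \sum_(A : k.-tuple 'I_n)
    a I * (\prod_(r < k) invmx G (tnth I r) (tnth A r)) * b [tuple of A ++ J].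

(** The form taken by [contract] in an orthonormal coframe. *)
Definition dot (R : realType) n k m (a : comps R n k) (b : comps R n (k + m)) :
    comps R n m :=
  fun J => \sum_(I : k.-tuple 'I_n) a I * b [tuple of I ++ J].

Section Pullback.
Variables (R : realType) (n : nat).
Implicit Types (E F G : 'M[R]_n).

Lemma prod_delta k (A B : k.-tuple 'I_n) :
  \prod_(r < k) (1%:M : 'M[R]_n) (tnth A r) (tnth B r) = (A == B)%:R.
Proof.
have [->|/eqP AB] := eqVneq A B.
  by rewrite big1 // => r _; rewrite mxE eqxx.
have [r rAB] : exists r, tnth A r != tnth B r.
  apply/existsP; apply: contra_notT AB => /existsPn AB.
  by apply: eq_from_tnth => r; apply/eqP; have := AB r; rewrite negbK.
by rewrite (bigD1 r) //= mxE (negPf rAB) mul0r.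
Qed.

Lemma pull1 k (a : comps R n k) : pull 1%:M a = a.
Proof.
apply/funext => I; rewrite /pull (bigD1 I) //= prod_delta eqxx mulr1.
by rewrite big1 ?addr0 // => A /negPf AI; rewrite prod_delta AI mulr0.
Qed.

Lemma pull_pull E F k (a : comps R n k) : pull E (pull F a) = pull (F *m E) a.
Proof.
apply/funext => I; rewrite /pull.
under eq_bigr => A _ do rewrite big_distrl.
rewrite exchange_big; apply: eq_bigr => B _ /=.
under eq_bigr => A _ do rewrite -mulrA -big_split /=.
rewrite -big_distrr /= -(prod_sum_tnth
  (fun r x => F (tnth B r) x * E x (tnth I r))).
by congr (_ * _); apply: eq_bigr => r _; rewrite mxE.
Qed.

Lemma pullK E k : E \in unitmx -> 
  cancel (@pull R n E k) (@pull R n (invmx E) k).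
Proof. by move=> Eu a; rewrite pull_pull mulmxV // pull1. Qed.

Lemma pullKV E k : E \in unitmx ->
  cancel (@pull R n (invmx E) k) (@pull R n E k).
Proof. by move=> Eu a; rewrite pull_pull mulVmx // pull1. Qed.

Lemma pullD E k (a b : comps R n k) x y :
  pull E (fun I => x * a I + y * b I) =
  (fun I => x * pull E a I + y * pull E b I).
Proof.
apply/funext => I; rewrite /pull !big_distrr -big_split /=.
by apply: eq_bigr => A _; rewrite mulrDl !mulrA.
Qed.

Lemma pullZ E k (a : comps R n k) x :
  pull E (fun I => x * a I) = (fun I => x * pull E a I).
Proof.
apply/funext => I; rewrite /pull big_distrr /=.
by apply: eq_bigr => A _; rewrite mulrA.
Qed.

Lemma pull_alternating E k (a : comps R n k) :
  alternating a -> alternating (pull E a).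
Proof.
move=> aa s I; rewrite -/(permute s I) /pull (sum_permute s) big_distrr /=.
apply: eq_bigr => A _; rewrite [a _]aa -mulrA; congr (_ * (_ * _)).
rewrite [RHS](reindex_inj (@perm_inj _ s)); apply: eq_bigr => r _.
by rewrite !tnth_permute.
Qed.

Lemma prod_cat k l (A I : k.-tuple 'I_n) (B J : l.-tuple 'I_n) E :
  \prod_(r < k + l) E (tnth [tuple of A ++ B] r) (tnth [tuple of I ++ J] r) =
  (\prod_(r < k) E (tnth A r) (tnth I r)) *
  (\prod_(r < l) E (tnth B r) (tnth J r)).
Proof.
by rewrite big_split_ord /=; congr (_ * _); apply: eq_bigr => r _;
  rewrite ?tnth_lshift ?tnth_rshift.
Qed.

(** With [H] the pulled back metric, [E H^-1 E^T = G^-1]. This absorbs the factors of [E] on the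
    contracted slots and leaves those on the [m] free slots. *)
Lemma contract_pull E G k m (a : comps R n k) (b : comps R n (k + m)) :
  E \in unitmx -> G \in unitmx ->
  contract (E^T *m G *m E) (pull E a) (pull E b) = pull E (contract G a b).
Proof.
move=> Eu Gu; set H := E^T *m G *m E.
have Hu : H \in unitmx by rewrite !unitmx_mul unitmx_tr Eu Gu.
have EHE : E *m invmx H *m E^T = invmx G.
  have HE : invmx H *m (E^T *m G) = invmx E.
    by rewrite -[LHS](mulmxK Eu) -(mulmxA (invmx H)) mulVmx // mul1mx.
  by rewrite -[LHS](mulmxK Gu) -(mulmxA _ E^T) -(mulmxA E) HE mulmxV // mul1mx.
(* The same cancellation in [k] slots at once, by distributing the product over the sums in the
   matrix entries. *)
have key (A B : k.-tuple 'I_n) :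
  \sum_(I : k.-tuple 'I_n) \sum_(J : k.-tuple 'I_n)
    (\prod_(r < k) E (tnth A r) (tnth I r)) *
    (\prod_(r < k) invmx H (tnth I r) (tnth J r)) *
    (\prod_(r < k) E (tnth B r) (tnth J r)) =
  \prod_(r < k) invmx G (tnth A r) (tnth B r).
  rewrite -EHE exchange_big /=.
  under [RHS]eq_bigr => r _.
    rewrite mxE; under eq_bigr => x _ do rewrite mxE mxE big_distrl /=.
    over.
  rewrite prod_sum_tnth; apply: eq_bigr => J _.
  rewrite (prod_sum_tnth (fun r x => E (tnth A r) x *
    invmx H x (tnth J r) * E (tnth B r) (tnth J r))).
  by apply: eq_bigr => I _; rewrite -!big_split.
apply/funext => J; rewrite /contract /pull.
transitivity (\sum_(A : k.-tuple 'I_n) \sum_(B : k.-tuple 'I_n)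
  \sum_(C : m.-tuple 'I_n) a A * b [tuple of B ++ C] *
   (\prod_(r < m) E (tnth C r) (tnth J r)) *
  \sum_(I : k.-tuple 'I_n) \sum_(K : k.-tuple 'I_n)
    (\prod_(r < k) E (tnth A r) (tnth I r)) *
    (\prod_(r < k) invmx H (tnth I r) (tnth K r)) *
    (\prod_(r < k) E (tnth B r) (tnth K r))).
  (* The pullbacks are expanded into a fivefold sum. Then [A], [B] and [C] are brought outside, so
     that the sums over [I] and [K] take the form of [key]. *)
  transitivity (\sum_(I : k.-tuple 'I_n) \sum_(K : k.-tuple 'I_n)
    \sum_(A : k.-tuple 'I_n) \sum_(B : k.-tuple 'I_n)
    \sum_(C : m.-tuple 'I_n) a A * b [tuple of B ++ C] *
    (\prod_(r < m) E (tnth C r) (tnth J r)) *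
    ((\prod_(r < k) E (tnth A r) (tnth I r)) *
    (\prod_(r < k) invmx H (tnth I r) (tnth K r)) *
    (\prod_(r < k) E (tnth B r) (tnth K r)))).
    apply: eq_bigr => I _; apply: eq_bigr => K _.
    rewrite !big_distrl /=; apply: eq_bigr => A _.
    rewrite sum_tuple_cat big_distrr /=; apply: eq_bigr => B _.
    rewrite big_distrr /=; apply: eq_bigr => C _.
    rewrite prod_cat; set x1 := \prod_(r < k) _; set x2 := \prod_(r < k) _.
    set x3 := \prod_(r < k) _; set x4 := \prod_(r < m) _.
    move: (a A) (b _) x1 x2 x3 x4 => y z x1 x2 x3 x4; ring.
  under eq_bigr => I _ do rewrite exchange_big /=.
  rewrite exchange_big /=; apply: eq_bigr => A _.
  under eq_bigr => I _ do rewrite exchange_big /=.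
  rewrite exchange_big /=; apply: eq_bigr => B _.
  under eq_bigr => I _ do rewrite exchange_big /=.
  rewrite exchange_big /=; apply: eq_bigr => C _.
  by rewrite big_distrr /=; apply: eq_bigr => I _; rewrite big_distrr.
under [RHS]eq_bigr => C _ do rewrite big_distrl /=.
rewrite [RHS]exchange_big /=; apply: eq_bigr => A _.
under [RHS]eq_bigr => C _ do rewrite big_distrl /=.
rewrite [RHS]exchange_big /=; apply: eq_bigr => B _.
apply: eq_bigr => C _; rewrite key.
set x1 := \prod_(r < k) _; set x2 := \prod_(r < m) _.
move: (a A) (b _) x1 x2 => y z x1 x2; ring.
Qed.

Lemma contract1 k m (a : comps R n k) (b : comps R n (k + m)) :
  contract 1%:M a b = dot a b.
Proof.
apply/funext => J; apply: eq_bigr => I _; rewrite (bigD1 I) //= invmx1.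
rewrite prod_delta eqxx mulr1 big1 ?addr0 // => A /negPf AI.
by rewrite prod_delta eq_sym AI mulr0 mul0r.
Qed.

Lemma contract_pull_dot E k m (a : comps R n k) (b : comps R n (k + m)) :
  E \in unitmx ->
  contract (E^T *m E) (pull E a) (pull E b) = pull E (dot a b).
Proof.
by move=> Eu; rewrite -contract1 -contract_pull ?unitmx1 // mulmx1.
Qed.

Lemma wedge_pull E k l (a : comps R n k) (b : comps R n l) :
  wedge (pull E a) (pull E b) = pull E (wedge a b).
Proof.
apply/funext => I; rewrite /wedge pullZ; congr (_ * _).
rewrite /pull; under [RHS]eq_bigr => A _ do rewrite big_distrl /=.
rewrite exchange_big /=; apply: eq_bigr => s _.
rewrite (sum_permute (s^-1)%g) sum_tuple_cat.
rewrite -mulrA [in LHS]big_distrl big_distrr /=; apply: eq_bigr => A _.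
rewrite !big_distrr /=; apply: eq_bigr => B _.
(* Reindexing the product over the slots by [s] moves the permutation onto [I], which splits into
   the two blocks that [wedge] prescribes. *)
have -> : \prod_(r < k + l) E (tnth (permute (s^-1)%g [tuple of A ++ B]) r)
     (tnth I r) = \prod_(r < k + l) E (tnth [tuple of A ++ B] r)
     (tnth [tuple of [tuple tnth I (s (lshift l r)) | r < k] ++
                     [tuple tnth I (s (rshift k r)) | r < l]] r).
  rewrite (reindex_inj (@perm_inj _ s)); apply: eq_bigr => r _.
  rewrite tnth_permute permK; congr (E _ _).
  by case: (split_ordP r) => j ->;
    rewrite ?tnth_lshift ?tnth_rshift tnth_mktuple.
rewrite prod_cat.
rewrite permuteV_lshift permuteV_rshift.
set x5 := \prod_(r < k) _; set x6 := \prod_(r < l) _.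
move: (a A) (b B) x5 x6 => x3 x4 x5 x6.
by rewrite -!mulrA; congr (_ * (_ * _)); rewrite mulrCA.
Qed.

End Pullback.

(** * Alternating components *)

Section BlockPerm.
Variables (k l : nat).

Definition block_fun (s : 'S_k) (t : 'S_l) (i : 'I_(k + l)) : 'I_(k + l) :=
  match fintype.split i with
  | inl j => lshift l (s j)
  | inr j => rshift k (t j)
  end.

Lemma block_fun_inj s t : injective (block_fun s t).
Proof.
apply: (@can_inj _ _ _ (block_fun s^-1%g t^-1%g)) => i; rewrite /block_fun.
by case: (split_ordP i) => j ->; rewrite ?(unsplitK (inl _)) ?(unsplitK (inr _))
  permK.
Qed.

Definition block_perm s t : 'S_(k + l) := perm (@block_fun_inj s t).

Lemma block_perm_lshift s t i : block_perm s t (lshift l i) = lshift l (s i).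
Proof. by rewrite permE /block_fun (unsplitK (inl _)). Qed.

Lemma block_perm_rshift s t i : block_perm s t (rshift k i) = rshift k (t i).
Proof. by rewrite permE /block_fun (unsplitK (inr _)). Qed.

(** The sign is the determinant of the permutation matrix, which is block diagonal here. *)
Lemma sign_block_perm (R : comPzRingType) s t :
  (-1) ^+ block_perm s t = (-1) ^+ s * (-1) ^+ t :> R.
Proof.
rewrite -!det_perm -(@det_ublock _ k l _ 0); congr (\det _).
apply/matrixP => i j.
case: (split_ordP i) => i' ->; case: (split_ordP j) => j' ->.
- by rewrite block_mxEul !mxE block_perm_lshift eq_lshift.
- by rewrite block_mxEur !mxE block_perm_lshift eq_lrshift.
- by rewrite block_mxEdl !mxE block_perm_rshift eq_rlshift.
- by rewrite block_mxEdr !mxE block_perm_rshift eq_rshift.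
Qed.

Lemma permute_cat T s t (A : k.-tuple T) (B : l.-tuple T) :
  permute (block_perm s t) [tuple of A ++ B] =
  [tuple of permute s A ++ permute t B].
Proof.
apply: eq_from_tnth => r; rewrite tnth_permute.
by case: (split_ordP r) => i ->; rewrite ?block_perm_lshift ?block_perm_rshift
  ?tnth_lshift ?tnth_rshift tnth_permute.
Qed.

End BlockPerm.

Section Alternating.
Variables (R : realType) (n : nat).

Lemma alternating_catl k l (T : comps R n (k + l)) (B : l.-tuple 'I_n) :
  alternating T -> alternating (fun A : k.-tuple 'I_n => T [tuple of A ++ B]).
Proof.
move=> Ta s I; rewrite -/(permute s I).
have := Ta (block_perm s 1%g) [tuple of I ++ B].
by rewrite -/(permute _ _) permute_cat permute1 sign_block_perm odd_perm1 mulr1.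
Qed.

Lemma alternating_catr k l (T : comps R n (k + l)) (A : k.-tuple 'I_n) :
  alternating T -> alternating (fun B : l.-tuple 'I_n => T [tuple of A ++ B]).
Proof.
move=> Ta s I; rewrite -/(permute s I).
have := Ta (block_perm 1%g s) [tuple of A ++ I].
by rewrite -/(permute _ _) permute_cat permute1 sign_block_perm odd_perm1 mul1r.
Qed.

Lemma contract_alternating k m (G : 'M[R]_n) (a : comps R n k)
    (b : comps R n (k + m)) : alternating b -> alternating (contract G a b).
Proof.
move=> ba s J; rewrite -/(permute s J) /contract !big_distrr /=.
apply: eq_bigr => I _; rewrite big_distrr /=; apply: eq_bigr => A _.
by rewrite [b _](alternating_catr A ba) mulrCA.
Qed.

Lemma wedge_alternating k l (a : comps R n k) (b : comps R n l) :
  alternating (wedge a b).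
Proof.
move=> s I; rewrite /wedge mulrCA; congr (_ * _); rewrite big_distrr /=.
(* Replacing [t] by [t * s^-1] cancels the permutation of [I] and leaves its sign. *)
rewrite (reindex_inj (mulIg s^-1)%g) /=; apply: eq_bigr => t _.
rewrite odd_permM odd_permV signr_addb -!mulrA mulrCA; congr (_ * (_ * _)).
have E r : tnth [tuple tnth I (s r0) | r0 < k + l] ((t * s^-1)%g r) =
           tnth I (t r) by rewrite tnth_mktuple permM permKV.
by congr (a _ * b _); apply: eq_mktuple => r; rewrite E.
Qed.

(** Transposing the two equal slots gives [a I = - a I]. *)
Lemma alternating_repeat k (a : comps R n k) (I : k.-tuple 'I_n) r s :
  alternating a -> r != s -> tnth I r = tnth I s -> a I = 0.
Proof.
move=> aa rs Irs; have := aa (tperm r s) I.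
rewrite odd_tperm rs expr1 mulN1r.
have -> : [tuple tnth I (tperm r s r0) | r0 < k] = I.
  by apply: eq_from_tnth => x; rewrite tnth_mktuple; case: tpermP => // ->.
by move=> /eqP; rewrite -addr_eq0 -mulr2n mulrn_eq0 /= => /eqP.
Qed.

Lemma alternating_linear k (a b : comps R n k) x y :
  alternating a -> alternating b -> alternating (fun I => x * a I + y * b I).
Proof.
move=> aa ba s I; rewrite aa ba mulrDr.
by rewrite [x * _]mulrCA [y * _]mulrCA.
Qed.

(* The [A]-minor e^{A1} /\ ... /\ e^{Ak} of the coframe [E]. *)
Definition minor k (E : 'M[R]_n) (A : k.-tuple 'I_n) : comps R n k :=
  fun I => \det (\matrix_(r, s) E (tnth A r) (tnth I s)).

Lemma minor_alternating k E (A : k.-tuple 'I_n) : alternating (minor E A).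
Proof.
move=> s I; rewrite /minor -det_tr -[in RHS]det_tr -det_perm.
rewrite -det_mulmx -row_permE; congr (\det _).
by apply/matrixP => i j; rewrite !mxE tnth_mktuple.
Qed.

Lemma minorE k (E : 'M[R]_n) (A I : k.-tuple 'I_n) : minor E A I =
  \sum_(s : 'S_k) (-1) ^+ s * \prod_(r < k) E (tnth A r) (tnth I (s r)).
Proof.
by apply: eq_bigr => s _; congr (_ * _); apply: eq_bigr => r _; rewrite mxE.
Qed.

Lemma minor1E k (A I : k.-tuple 'I_n) :
  minor (1%:M : 'M[R]_n) A I =
  \sum_(s : 'S_k) (-1) ^+ s * (permute s I == A)%:R.
Proof.
apply: eq_bigr => s _; congr (_ * _); rewrite eq_sym -(@prod_delta R).
by apply: eq_bigr => r _; rewrite mxE tnth_permute.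
Qed.

(* Only the permutations of [A] contribute, and each gives [T A]. *)
Lemma sum_minor k (T : comps R n k) (A : k.-tuple 'I_n) : alternating T ->
  \sum_I T I * minor 1%:M A I = k`!%:R * T A.
Proof.
move=> Ta.
under eq_bigr => I _ do rewrite minor1E big_distrr /=.
rewrite exchange_big /=.
transitivity (\sum_(s : 'S_k) T A); last first.
  by rewrite sumr_const card_Sn mulr_natl.
apply: eq_bigr => s _; rewrite (bigD1 (permute s^-1%g A)) //=.
rewrite permuteM mulgV permute1 eqxx mulr1 [T _]Ta odd_permV mulrAC -expr2.
rewrite sqrr_sign mul1r big1 ?addr0 // => I /negPf IA.
by rewrite (can2_eq (permuteK s) (permuteKV s)) IA !mulr0.
Qed.

End Alternating.

(** * Minors and the Levi-Civita symbol *)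

Section Minors.
Variables (R : realType) (n : nat).
Implicit Types (E : 'M[R]_n).

(** [minor 1%:M A] is the coordinate form dx^A, and substituting e^a for each dx^a turns it into
    e^A. *)
Lemma pull_minor k E (A : k.-tuple 'I_n) : pull E (minor 1%:M A) = minor E A.
Proof.
apply/funext => I; rewrite /pull.
under eq_bigr => B _ do rewrite minor1E big_distrl /=.
rewrite exchange_big /=; apply: eq_bigr => s _.
rewrite (bigD1 (permute s^-1%g A)) //= permuteKV eqxx mulr1.
rewrite [X in _ + X]big1 ?addr0 => [|B /negPf BA]; last first.
  by rewrite (can2_eq (permuteK s) (permuteKV s)) BA mulr0 mul0r.
congr (_ * _); rewrite (reindex_inj (@perm_inj _ s)); apply: eq_bigr => r _.
by rewrite tnth_permute permK mxE.
Qed.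

(** Once both determinants are expanded, permutations [t] and [u] of the blocks combine with the
    shuffle [s] into one permutation of all slots. For fixed [t] and [u] the sum over [s] is the
    full determinant, and the number [k! l!] of pairs cancels the normalization of [wedge]. *)
Lemma wedge_minor k l E (A : k.-tuple 'I_n) (B : l.-tuple 'I_n) :
  wedge (minor E A) (minor E B) = minor E [tuple of A ++ B].
Proof.
apply/funext => I; rewrite /wedge.
have kl0 : (k`! * l`!)%:R != 0 :> R
  by rewrite pnatr_eq0 -lt0n muln_gt0 !fact_gt0.
apply: (canLR (mulKf kl0)).
transitivity (\sum_(s : 'S_(k + l)) \sum_(t : 'S_k) \sum_(u : 'S_l)
   (-1) ^+ (block_perm t u * s)%g * \prod_(r < k + l)
     E (tnth [tuple of A ++ B] r) (tnth I ((block_perm t u * s)%g r))).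
  apply: eq_bigr => s _; rewrite !minorE -mulrA big_distrl big_distrr.
  apply: eq_bigr => t _; rewrite !big_distrr; apply: eq_bigr => u _ /=.
  rewrite odd_permM signr_addb sign_block_perm big_split_ord.
  under eq_bigr => r _ do rewrite tnth_mktuple.
  under [X in _ * (_ * (_ * X))]eq_bigr => r _ do rewrite tnth_mktuple.
  under [X in _ = _ * (X * _)]eq_bigr => r _
    do rewrite tnth_lshift permM block_perm_lshift.
  under [X in _ = _ * (_ * X)]eq_bigr => r _
    do rewrite tnth_rshift permM block_perm_rshift.
  set x := \prod_(r < k) _; set y := \prod_(r < l) _.
  by rewrite [_ * _ ^+ s]mulrC -[RHS]mulrA mulrACA.
rewrite exchange_big /=.
under eq_bigr => t _ do rewrite exchange_big /=.
transitivity (\sum_(t : 'S_k) \sum_(u : 'S_l) minor E [tuple of A ++ B] I).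
  apply: eq_bigr => t _; apply: eq_bigr => u _.
  rewrite -(reindex_inj (mulgI (block_perm t u)) (P := predT)
    (F := fun s : 'S_(k + l) => (-1) ^+ s * \prod_(r < k + l)
       E (tnth [tuple of A ++ B] r) (tnth I (s r)))) /=.
  apply: eq_bigr => s _; congr (_ * _); apply: eq_bigr => r _.
  by rewrite mxE.
rewrite !sumr_const !card_Sn -mulrnA mulr_natl.
by rewrite mulnC.
Qed.

(** The sign of each of the [(k + l)!] permutations in [wedge] is absorbed by reordering the slots
    of [T], so all of them contribute equally. *)
Lemma sum_wedge k l (a : comps R n k) (b : comps R n l)
    (T : comps R n (k + l)) :
  alternating T ->
  \sum_I wedge a b I * T I =
  (k + l)`!%:R / (k`! * l`!)%:R *
  \sum_(A : k.-tuple 'I_n) \sum_(B : l.-tuple 'I_n)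
    a A * b B * T [tuple of A ++ B].
Proof.
move=> Ta.
under eq_bigr => I _ do rewrite /wedge -mulrA big_distrl.
rewrite -big_distrr exchange_big /=.
pose c := \sum_(A : k.-tuple 'I_n) \sum_(B : l.-tuple 'I_n)
    a A * b B * T [tuple of A ++ B].
rewrite -/c mulrAC [RHS]mulrC; congr (_ * _).
transitivity (\sum_(s : 'S_(k + l)) c); last first.
  by rewrite sumr_const card_Sn mulr_natl.
apply: eq_bigr => s _; rewrite (sum_permute s^-1%g) sum_tuple_cat.
apply: eq_bigr => A _; apply: eq_bigr => B _.
rewrite permuteV_lshift permuteV_rshift.
rewrite [T _]Ta odd_permV -!mulrA (mulrCA (b B)) (mulrCA (a A)).
exact: signrMK.
Qed.

(** The Levi-Civita symbol, written as a minor so that the results on minors apply to it. *)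
Definition eps : comps R n n := minor 1%:M [tuple r | r < n].

Lemma epsE I : eps I = \det (\matrix_(r, s) (tnth I r == s)%:R).
Proof.
rewrite /eps /minor -det_tr; congr (\det _); apply/matrixP => r s.
by rewrite !mxE tnth_mktuple eq_sym.
Qed.

Lemma eps_alternating : alternating eps.
Proof. exact: minor_alternating. Qed.

(** The square root of [det (E^T E)] is [|det E|], and the orientation sign turns it into [det E].
    Hence the volume form is e^1 /\ ... /\ e^n. *)
Lemma volume_pull E (o : R) : o = 1 \/ o = -1 -> 0 < o * \det E ->
  volume (E^T *m E) o = pull E eps.
Proof.
move=> o1 oE; apply/funext => I; rewrite pull_minor /volume.
have -> : o * Num.sqrt (\det (E^T *m E)) = \det E.
  rewrite det_mulmx det_tr -expr2 sqrtr_sqr.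
  case: o1 oE => ->; first by rewrite !mul1r => /gtr0_norm.
  by rewrite !mulN1r oppr_gt0 => /ltr0_norm ->; rewrite opprK.
rewrite -[X in _ * X]det_tr -det_mulmx; congr (\det _); apply/matrixP => r s.
rewrite !mxE tnth_mktuple (bigD1 (tnth I s)) //= !mxE eqxx mulr1 big1 ?addr0 //.
by move=> c; rewrite !mxE eq_sym => /negPf ->; rewrite mulr0.
Qed.

End Minors.

(* Laplace expansion of the symbol along the slots complementary to [I]. *)
Lemma eps_cat (R : realType) k l (I : k.-tuple 'I_(k + l))
    (K J : l.-tuple 'I_(k + l)) :
  injective (tnth [tuple of I ++ K]) ->
  eps R [tuple of I ++ J] = eps R [tuple of I ++ K] * minor 1%:M K J.
Proof.
move=> inj; pose s : 'S_(k + l) := perm inj.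
have eps_s C : eps R C = (-1) ^+ s * \det (\matrix_(r, c) (tnth C r == s c)%:R).
  rewrite epsE -[in RHS]det_perm mulrC -det_mulmx; congr (\det _).
  apply/matrixP => r c; rewrite !mxE.
  rewrite (bigD1 ((s^-1)%g c)) //= !mxE permKV eqxx mulr1 big1 ?addr0 // => d.
  by rewrite !mxE -(inj_eq (@perm_inj _ s)) permKV => /negPf ->; rewrite mulr0.
have eK : eps R [tuple of I ++ K] = (-1) ^+ s.
  rewrite eps_s -[RHS]mulr1; congr (_ * _).
  rewrite -[RHS](det1 R (k + l)); congr (\det _); apply/matrixP => r c.
  by rewrite !mxE permE (inj_eq inj).
rewrite eK eps_s; congr (_ * _).
(* With [s] factored out, the columns are indexed by [I] and then [K]. These are disjoint, so the
   matrix is block lower triangular, its diagonal blocks being the identity and, up to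
   transposition, the matrix of the minor. *)
rewrite -[RHS]mul1r -[X in X * _](det1 R k) /minor -det_tr.
rewrite -[X in _ = _ * X]det_tr.
rewrite -(@det_lblock _ k l _ (\matrix_(r, c) (tnth J r == tnth I c)%:R)).
have sl c : s (lshift l c) = tnth I c by rewrite permE tnth_lshift.
have sr c : s (rshift k c) = tnth K c by rewrite permE tnth_rshift.
congr (\det _); apply/matrixP => r c.
case: (split_ordP r) => r' ->; case: (split_ordP c) => c' ->.
- rewrite block_mxEul !mxE tnth_lshift -!sl (inj_eq (@perm_inj _ s)).
  by rewrite eq_lshift eq_sym.
- rewrite block_mxEur !mxE tnth_lshift -sl (inj_eq (@perm_inj _ s)).
  by rewrite eq_lrshift.
- by rewrite block_mxEdl !mxE tnth_rshift sl.
- by rewrite block_mxEdr !mxE tnth_rshift sr eq_sym.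
Qed.

Lemma eps_inj (R : realType) n (I : n.-tuple 'I_n) :
  injective (tnth I) -> eps R I != 0.
Proof.
move=> inj; have -> : I = permute (perm inj) [tuple r | r < n].
  by apply: eq_from_tnth => r; rewrite tnth_permute tnth_mktuple permE.
rewrite eps_alternating mulf_neq0 ?signr_eq0 //.
suff -> : eps R [tuple r | r < n] = 1 by exact: oner_neq0.
rewrite -[RHS](det1 R n); congr (\det _); apply/matrixP => r s.
by rewrite !mxE !tnth_mktuple.
Qed.

(* If [I] is injective and omits [d], the sum at [d] is n! eps(d, I) w(I). *)
Lemma alternating_eps_eq0 (R : realType) n (w : comps R (1 + n) n) :
  alternating w ->
  (forall d, \sum_I w I * eps R [tuple of [tuple d] ++ I] = 0) ->
  forall I, w I = 0.
Proof.
move=> wa w0 I.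
have [/injectiveP injI|/injectivePn[r [s rs Irs]]] :=
  boolP (injectiveb (tnth I)); last exact: alternating_repeat wa rs Irs.
have [d dI] : exists d, d \notin I.
  apply/existsP; apply: contraT => /existsPn dI.
  have : (#|'I_(1 + n)| <= size I)%N.
    apply: leq_trans (card_size I); apply: subset_leq_card.
    by apply/fintype.subsetP => d _; rewrite -[_ \in _]negbK dI.
  by rewrite card_ord size_tuple add1n ltnn.
have inj : injective (tnth [tuple of [tuple d] ++ I]).
  apply/tuple_uniqP; rewrite /= dI; exact/tuple_uniqP.
have := w0 d; under eq_bigr => J _ do rewrite (eps_cat R _ inj) mulrCA.
rewrite -big_distrr /= sum_minor // => /eqP.
by rewrite !mulf_eq0 (negPf (eps_inj R inj)) pnatr_eq0 eqn0Ngt fact_gt0 => /eqP.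
Qed.

(** * The model form *)

Definition sumz (n : nat) (f : nat -> int) : int :=
  foldr (fun k acc => f k + acc) 0 (iota 0 n).

(* Laplace expansion along the first row. The entries are integers so that the
   Levi-Civita symbol and the model form can be evaluated by computation. *)
Fixpoint ldet (n : nat) (f : nat -> nat -> int) : int :=
  if n is n'.+1 then
    sumz n (fun k => if f 0%N k == 0 then 0 else
      (if odd k then -1 else 1) * f 0%N k *
      ldet n' (fun r s => f r.+1 (bump k s)))
  else 1.

(** The generalized Kronecker delta, a computable counterpart of [minor 1%:M]. *)
Definition delta_det (A I : seq nat) : int :=
  ldet (size A) (fun r s => if nth 0%N A r == nth 0%N I s then 1 else 0).

(* The coefficients of the standard form, with the indices shifted to 0..7. *)
Definition spin_blocks : seq (int * seq nat) :=
  [:: (-1, [:: 0; 1; 2; 3]%N); (-1, [:: 0; 1; 4; 5]%N);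
      (-1, [:: 0; 1; 6; 7]%N); (-1, [:: 2; 3; 4; 5]%N);
      (-1, [:: 2; 3; 6; 7]%N); (-1, [:: 4; 5; 6; 7]%N);
      (-1, [:: 0; 2; 4; 6]%N); (1, [:: 0; 2; 5; 7]%N);
      (1, [:: 0; 3; 4; 7]%N); (1, [:: 0; 3; 5; 6]%N);
      (1, [:: 1; 2; 4; 7]%N); (1, [:: 1; 2; 5; 6]%N);
      (1, [:: 1; 3; 4; 6]%N); (-1, [:: 1; 3; 5; 7]%N)].

Definition spin_coef (I : seq nat) : int :=
  foldr (fun t acc => t.1 * delta_det t.2 I + acc) 0 spin_blocks.

(* Tabulated, so that checking the 8^4 cases of the quadratic identity is a
   matter of look-ups. *)
Definition spin_table : seq (seq (seq (seq int))) := Eval vm_compute in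
  [seq [seq [seq [seq spin_coef [:: i; j; k; l] | l <- iota 0 8]
    | k <- iota 0 8] | j <- iota 0 8] | i <- iota 0 8].

Definition spin_entry (i j k l : nat) : int :=
  nth 0 (nth [::] (nth [::] (nth [::] spin_table i) j) k) l.

Lemma spin_tableE : spin_table =
  [seq [seq [seq [seq spin_coef [:: i; j; k; l] | l <- iota 0 8]
    | k <- iota 0 8] | j <- iota 0 8] | i <- iota 0 8].
Proof. by vm_compute. Qed.

Definition all8 (P : nat -> bool) : bool := all P (iota 0 8).

(** The quadratic identity for phi at all index quadruples. Vanishing entries are skipped to shorten
    the computation. *)
Definition spin_square_check : bool :=
  all8 (fun i => all8 (fun j => all8 (fun k => all8 (fun l =>
    sumz 8 (fun a => sumz 8 (fun b =>
      if spin_entry i j a b == 0 then 0 else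
      spin_entry i j a b * spin_entry a b k l)) ==
    - 4 * spin_entry i j k l +
    (if (i == k) && (j == l) then 6 else 0) -
    (if (i == l) && (j == k) then 6 else 0))))).

Lemma spin_square_check_true : spin_square_check.
Proof. by vm_compute. Qed.

Definition compl8 (A : seq nat) : seq nat := [seq x <- iota 0 8 | x \notin A].

(** The Hodge star sends a block to its complement, with the sign of their concatenation. The
    fourteen signed blocks are thereby permuted among themselves. *)
Lemma spin_self_dual_check :
  perm_eq [seq (t.1 * delta_det (iota 0 8) (t.2 ++ compl8 t.2), compl8 t.2)
    | t <- spin_blocks] spin_blocks.
Proof. by vm_compute. Qed.

(** * Transfer of the integer computations to components *)

Lemma sumzE (R : pzRingType) n (f : nat -> int) :
  (sumz n f)%:~R = \sum_(i < n) (f i)%:~R :> R.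
Proof.
rewrite -(big_mkord xpredT (fun i => (f i)%:~R)) /index_iota subn0 /sumz.
elim: (iota 0 n) => [|k r IH]; first by rewrite big_nil.
by rewrite big_cons -IH -intrD.
Qed.

Lemma ldetE (R : comPzRingType) n (f : nat -> nat -> int) :
  (ldet n f)%:~R = \det (\matrix_(r < n, s < n) (f r s)%:~R) :> R.
Proof.
elim: n f => [|n IH] f; first by rewrite det_mx00.
rewrite (expand_det_row _ ord0) sumzE; apply: eq_bigr => k _.
rewrite mxE /cofactor /= add0n -signr_odd; case: eqP => [->|_].
  by rewrite mul0r.
rewrite !intrM IH mulrCA mulrA; congr (_ * _ * _); last first.
  by congr (\det _); apply/matrixP => r s; rewrite !mxE.
by case: odd.
Qed.

Lemma delta_detE (R : realType) k (A I : k.-tuple 'I_8) :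
  minor (1%:M : 'M[R]_8) A I = (delta_det (map val A) (map val I))%:~R.
Proof.
rewrite /delta_det size_map size_tuple ldetE; congr (\det _).
apply/matrixP => r s; rewrite !mxE.
rewrite !(nth_map ord0) ?size_tuple // -!tnth_nth.
by rewrite val_eqE; case: eqP.
Qed.

Lemma all8P (P : nat -> bool) : all8 P -> forall i : 'I_8, P i.
Proof. by move=> /allP h i; apply: h; rewrite mem_iota ltn_ord. Qed.

Lemma spin_entryE (i j k l : 'I_8) :
  spin_entry i j k l = spin_coef [:: val i; val j; val k; val l].
Proof.
rewrite /spin_entry spin_tableE.
rewrite !(nth_map 0%N) ?size_iota ?ltn_ord // !nth_iota ?ltn_ord //.
Qed.

(** Both [nth] and [inord] default to 0, so the list is represented faithfully only if it has length
    [k] and entries below 8. *)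
Definition tuple_of_seq k (s : seq nat) : k.-tuple 'I_8 :=
  [tuple inord (nth 0%N s r) | r < k].

Lemma val_tuple_of_seq k s : size s = k -> all (ltn^~ 8) s ->
  map val (tuple_of_seq k s) = s.
Proof.
move=> ks /allP s8; apply: (@eq_from_nth _ 0%N).
  by rewrite size_map size_tuple.
rewrite size_map size_tuple => i ik; rewrite (nth_map ord0) ?size_tuple //.
rewrite (_ : i = Ordinal ik) // -tnth_nth tnth_mktuple.
by apply: inordK; apply: s8; rewrite mem_nth // ks.
Qed.

(** * Self-duality and the quadratic identity of the model form *)

Section ModelForm.
Variable R : realType.

Lemma coframe1E (E : 'M[R]_8) a :
  coframe1 E a = minor E [tuple (inord a.-1 : 'I_8)].
Proof. by apply/funext => I; rewrite /minor det_mx11 mxE. Qed.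

Lemma coframe4E (E : 'M[R]_8) i j k l :
  coframe4 E i j k l = minor E (tuple_of_seq 4 [:: i.-1; j.-1; k.-1; l.-1]).
Proof.
rewrite /coframe4 !coframe1E !wedge_minor; congr (minor E _).
apply: eq_from_tnth => r; rewrite tnth_mktuple (tnth_nth ord0).
by case: r => [[|[|[|[|]]]]].
Qed.

Lemma standard_formE (E : 'M[R]_8) I : standard_form E I =
  \sum_(t <- spin_blocks) t.1%:~R * minor E (tuple_of_seq 4 t.2) I.
Proof.
rewrite /standard_form !coframe4E !big_cons big_nil /=.
by rewrite !mulN1r !mul1r addr0 !opprD !opprK !addrA.
Qed.

Let phi : comps R 8 4 := standard_form 1%:M.

(** The form is a linear combination of minors of [E], each the pullback of the same minor of the
    identity. *)
Lemma standard_form_pull (E : 'M[R]_8) : standard_form E = pull E phi.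
Proof.
apply/funext => I; rewrite standard_formE /pull /phi.
under [RHS]eq_bigr => A _ do rewrite standard_formE big_distrl.
rewrite exchange_big; apply: eq_bigr => t _ /=.
by rewrite -pull_minor big_distrr; apply: eq_bigr => A _ /=; rewrite mulrA.
Qed.

Lemma standard_form1E I : phi I = (spin_coef (map val I))%:~R.
Proof.
rewrite /phi standard_formE /spin_coef.
have : all (fun t => (size t.2 == 4) && all (ltn^~ 8) t.2)%N spin_blocks by [].
elim: spin_blocks => [|t r IH] /=; first by rewrite big_nil.
move=> /andP[/andP[/eqP t4 t8] /IH {}IH].
by rewrite big_cons IH delta_detE val_tuple_of_seq // -intrM -intrD.
Qed.

Lemma map_val_id n : map val [tuple r | r < n] = iota 0 n.
Proof. by rewrite -val_enum_ord -[enum _ in RHS]map_id. Qed.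

Lemma eps8E (I : 8.-tuple 'I_8) :
  eps R I = (delta_det (iota 0 8) (map val I))%:~R.
Proof. by rewrite /eps delta_detE map_val_id. Qed.

(** Summing dx^A against the symbol gives [4! = 24] times the complementary form, with the sign of
    [A] followed by its complement. Reindexing the blocks by complementation gives the form back. *)
Lemma standard_form_self_dual (J : 4.-tuple 'I_8) :
  \sum_(A : 4.-tuple 'I_8) phi A * eps R [tuple of A ++ J] = 24 * phi J.
Proof.
rewrite /phi; under eq_bigr => A _ do rewrite standard_formE big_distrl.
rewrite exchange_big standard_formE /=.
rewrite -[in RHS](perm_big _ spin_self_dual_check) big_map big_distrr.
rewrite big_seq [RHS]big_seq; apply: eq_bigr => t tin.
have /allP/(_ t tin)/andP[/andP[/eqP t4 /eqP c4] /andP[u8 t8]] :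
  all (fun t => (size t.2 == 4) && (size (compl8 t.2) == 4) &&
    (uniq (t.2 ++ compl8 t.2) && all (ltn^~ 8) (t.2 ++ compl8 t.2)))%N
    spin_blocks by [].
pose A := tuple_of_seq 4 t.2; pose B := tuple_of_seq 4 (compl8 t.2).
have vAB : map val [tuple of A ++ B] = t.2 ++ compl8 t.2.
  move: t8; rewrite all_cat map_cat => /andP[t8 c8].
  by rewrite !val_tuple_of_seq.
have inj : injective (tnth [tuple of A ++ B]).
  by apply/tuple_uniqP; rewrite -(map_inj_uniq val_inj) vAB.
under eq_bigr => C _ do rewrite -mulrA [_ * eps _ _]mulrC.
rewrite -big_distrr /= sum_minor; last first.
  exact: (alternating_catl (k := 4) (l := 4) J (@eps_alternating R 8)).
rewrite (@eps_cat R 4 4 _ _ J inj) eps8E vAB intrM.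
by rewrite mulrCA !mulrA.
Qed.

Lemma standard_form_entry (i j k l : 'I_8) (I : 4.-tuple 'I_8) :
  val I = [:: i; j; k; l] -> phi I = (spin_entry i j k l)%:~R.
Proof. by move=> valI; rewrite standard_form1E valI spin_entryE. Qed.

(** The tabulated check read over [R]. In the last term the two indices of [J] are exchanged. *)
Lemma standard_form_square (I J : 2.-tuple 'I_8) :
  \sum_(K : 2.-tuple 'I_8) phi [tuple of I ++ K] * phi [tuple of K ++ J] =
  - 4 * phi [tuple of I ++ J] + 6 * (I == J)%:R
  - 6 * (I == permute (tperm ord0 ord_max) J)%:R.
Proof.
case: (tupleP I) => i I1; case: (tupleP I1) => j I2.
rewrite (tuple0 I2) {I1 I2}.
case: (tupleP J) => k J1; case: (tupleP J1) => l J2.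
rewrite (tuple0 J2) {J1 J2}.
have -> : permute (tperm ord0 ord_max) [tuple of k :: [tuple of l :: [tuple]]] =
  [tuple of l :: [tuple of k :: [tuple]]].
  apply: eq_from_tnth => r; rewrite tnth_permute !(tnth_nth ord0).
  by case: tpermP => [->|->|/eqP r0 /eqP r1] //; case: r r0 r1 => [[|[|]]].
rewrite -!val_eqE !eqseq_cons !andbT (@standard_form_entry i j k l) //.
have := spin_square_check_true; rewrite /spin_square_check.
move=> /all8P/(_ i)/all8P/(_ j)/all8P/(_ k)/all8P/(_ l)/eqP.
move=> /(congr1 (fun z : int => z%:~R : R)).
rewrite sumzE !intrD mulNr !rmorphN /= intrM.
have ifE (b : bool) : (if b then 6 else 0 : int)%:~R = 6 * b%:R :> R.
  by case: b; rewrite ?mulr1 ?mulr0.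
rewrite !ifE mulNr => <-.
rewrite sum_tuple_cons; apply: eq_bigr => a _.
rewrite sumzE sum_tuple1; apply: eq_bigr => b _.
rewrite (@standard_form_entry i j a b) // (@standard_form_entry a b k l) //.
by rewrite -intrM; case: eqP => [->|]; rewrite ?mul0r.
Qed.

(** Since [b] changes sign when its indices are exchanged, the two deltas of the quadratic identity
    add up to [12 * b J]. *)
Lemma dot_standard_form_square (b : comps R 8 2) : alternating b ->
  dot (m := 2) (dot (m := 2) b phi) phi =
  (fun J => - 4 * dot (m := 2) b phi J + 12 * b J).
Proof.
move=> ba; apply/funext => J; rewrite /dot.
under eq_bigr => K _ do rewrite big_distrl.
rewrite exchange_big /=.
under eq_bigr => I _.
  under eq_bigr => K _ do rewrite -mulrA.
  rewrite -big_distrr /= standard_form_square.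
  over.
pose J' := permute (tperm ord0 ord_max) J.
have bJ' : b J' = - b J by rewrite [b _]ba odd_tperm expr1 mulN1r.
transitivity (\sum_(I : 2.-tuple 'I_8) (- 4 * (b I * phi [tuple of I ++ J]) +
    (6 * (b I * (I == J)%:R) - 6 * (b I * (I == J')%:R)))).
  apply: eq_bigr => I _.
  by rewrite -addrA !mulrDr (mulrN _ (6 * _)) !(mulrCA (b I)).
have pick K : \sum_(I : 2.-tuple 'I_8) b I * (I == K)%:R = b K.
  rewrite (bigD1 K) //= eqxx mulr1 big1 ?addr0 // => I /negPf ->.
  by rewrite mulr0.
rewrite !big_split /= sumrN -!big_distrr /= !pick bJ'.
by rewrite mulrN opprK -mulrDl -natrD.
Qed.

(** The factors are [1/6!] from the star, [6!/(4! 2!)] from [sum_wedge] and [4! = 24] from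
    self-duality; their product is [1/2]. *)
Lemma hodge_wedge_standard_form (b : comps R 8 2) (J : 2.-tuple 'I_8) :
  6`!%:R^-1 * dot (m := 2) (wedge phi b) (@eps R 8) J =
  2^-1 * dot (m := 2) b phi J.
Proof.
rewrite /dot (sum_wedge (k := 4) (l := 2) _ _
  (alternating_catl (k := 6) (l := 2) J (@eps_alternating R 8))).
transitivity (6`!%:R^-1 * (6`!%:R / (4`! * 2`!)%:R *
  \sum_(B : 2.-tuple 'I_8) b B * (24 * phi [tuple of B ++ J]))).
  congr (_ * (_ * _)); rewrite exchange_big /=; apply: eq_bigr => B _.
  rewrite -standard_form_self_dual big_distrr; apply: eq_bigr => A _ /=.
  rewrite mulrAC mulrC; congr (b B * (phi A * eps R _)).
  by apply: val_inj; rewrite /= catA.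
under eq_bigr => B _ do rewrite mulrCA.
rewrite -big_distrr /= !mulrA; congr (_ * _).
have n0 m : m`!%:R != 0 :> R by rewrite pnatr_eq0 -lt0n fact_gt0.
rewrite mulVf // mul1r natrM invfM.
by rewrite (_ : 4`! = 24)%N // (_ : 2`! = 2)%N // mulrAC mulVf ?mul1r.
Qed.

(** Moving [d] past seven indices gives the sign -1, and exchanging blocks of lengths 3 and 4 gives
    an even permutation. *)
Lemma eps_reorder (A : 3.-tuple 'I_8) (B : 4.-tuple 'I_8) (d : 'I_8) :
  @eps R 8 [tuple of [tuple d] ++ [tuple of A ++ B]] =
  - @eps R 8 [tuple of B ++ [tuple of A ++ [tuple d]]].
Proof.
(* [T] lists the positions of [d], [A] and [B] within [B ++ A ++ [d]]; its sign is found by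
   computation. *)
pose T := tuple_of_seq 8 [:: 7; 4; 5; 6; 0; 1; 2; 3]%N.
have vT : map val T = [:: 7; 4; 5; 6; 0; 1; 2; 3]%N by apply: val_tuple_of_seq.
have inj : injective (tnth T).
  by apply/tuple_uniqP; rewrite -(map_inj_uniq val_inj) vT.
pose s : 'S_8 := perm inj.
have eps_s : (-1) ^+ s = -1 :> R.
  have : eps R T = -1.
    rewrite eps8E vT.
    by have -> : delta_det (iota 0 8) [:: 7; 4; 5; 6; 0; 1; 2; 3]%N = -1
      by vm_compute.
  have -> : T = permute s [tuple r | r < 8].
    by apply: eq_from_tnth => r; rewrite tnth_permute tnth_mktuple permE.
  have e1 : delta_det (iota 0 8) (iota 0 8) = 1 by vm_compute.
  by rewrite [eps R _]eps_alternating eps8E map_val_id e1 mulr1.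
rewrite -[RHS]mulN1r -eps_s -eps_alternating; congr (eps R _).
apply: eq_from_tnth => r; rewrite tnth_mktuple permE !(tnth_nth ord0).
rewrite -(nth_map ord0 0%N val) ?size_tuple // vT.
case: (tupleP A) => a0 A1; case: (tupleP A1) => a1 A2.
case: (tupleP A2) => a2 A3; rewrite (tuple0 A3) {A1 A2 A3}.
case: (tupleP B) => b0 B1; case: (tupleP B1) => b1 B2.
case: (tupleP B2) => b2 B3; case: (tupleP B3) => b3 B4.
rewrite (tuple0 B4) {B1 B2 B3 B4}.
by case: r => [[|[|[|[|[|[|[|[|r]]]]]]]] r8].
Qed.

(** The constant is [7!/(3! 4!)] from [sum_wedge] times [4! = 24] from self-duality, and the sign
    comes from [eps_reorder]. *)
Lemma wedge_standard_form_eps (w : comps R 8 3) (d : 'I_8) :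
  \sum_(I : 7.-tuple 'I_8) wedge w phi I * eps R [tuple of [tuple d] ++ I] =
  - (7`!%:R / 3`!%:R) * dot (m := 1) w phi [tuple d].
Proof.
rewrite (sum_wedge (k := 3) (l := 4) _ _
  (alternating_catr (k := 1) (l := 7) [tuple d] (@eps_alternating R 8))).
transitivity (7`!%:R / (3`! * 4`!)%:R *
  \sum_(A : 3.-tuple 'I_8) w A * - (24 * phi [tuple of A ++ [tuple d]])).
  congr (_ * _); apply: eq_bigr => A _.
  rewrite -standard_form_self_dual -sumrN big_distrr; apply: eq_bigr => B _ /=.
  by rewrite eps_reorder -mulrA mulrN.
under eq_bigr => A _ do rewrite mulrN mulrCA.
rewrite sumrN -big_distrr /= mulrN mulNr; congr (- _).
rewrite !mulrA; congr (_ * _).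
have n0 m : m`!%:R != 0 :> R by rewrite pnatr_eq0 -lt0n fact_gt0.
by rewrite natrM invfM -!mulrA (_ : 24 = 4`!%:R) // mulVf // mulr1.
Qed.

End ModelForm.

(** * Spin(7)-structures *)

Section Pointwise.
Variables (R : realType) (E : 'M[R]_8).
Hypothesis Eu : E \in unitmx.
Let G := E^T *m E.
Let Phi := standard_form E.

Lemma hodge_wedge_contract (o : R) (b : comps R 8 2) :
  o = 1 \/ o = -1 -> 0 < o * \det E ->
  @hodge R 6 2 G o (wedge Phi b) =
  (fun J => 2^-1 * contract (m := 2) G b Phi J).
Proof.
move=> o1 oE; rewrite -(pullKV Eu b) /Phi standard_form_pull wedge_pull.
rewrite contract_pull_dot // -pullZ.
(* By definition [hodge] is [1/6!] times the contraction with the volume form, which is the pullback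
   of [eps]. *)
transitivity (fun J => 6`!%:R^-1 * contract (k := 6) (m := 2) G
  (pull E (wedge (standard_form 1%:M) (pull (invmx E) b))) (volume G o) J)
  => //.
rewrite volume_pull // contract_pull_dot // -pullZ.
by congr pull; apply/funext => J; rewrite hodge_wedge_standard_form.
Qed.

Lemma contract_square (b : comps R 8 2) : alternating b ->
  contract (m := 2) G (contract (m := 2) G b Phi) Phi =
  (fun J => - 4 * contract (m := 2) G b Phi J + 12 * b J).
Proof.
move=> ba; rewrite -(pullKV Eu b) /Phi standard_form_pull !contract_pull_dot //.
rewrite dot_standard_form_square ?pullD //; exact: pull_alternating.
Qed.

(** In the model the contraction is a nonzero multiple of the covector dual to the 7-form, and a
    7-form in dimension 8 vanishes exactly when its dual does. *)
Lemma wedge_eq0_contract (w : comps R 8 3) :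
  (forall I, wedge w Phi I = 0) <->
  (forall d, contract (m := 1) G w Phi [tuple d] = 0).
Proof.
have pull0 k (a : comps R 8 k) :
    (forall I, a I = 0) -> forall I, pull E a I = 0.
  by move=> a0 I; rewrite /pull big1 // => A _; rewrite a0 mul0r.
have pull_eq0 k (a : comps R 8 k) :
    (forall I, pull E a I = 0) -> forall I, a I = 0.
  move=> pa0 I; rewrite -(pullK Eu a) (_ : pull E a = fun=> 0) ?/pull.
    by rewrite big1 // => A _; rewrite mul0r.
  exact/funext.
rewrite -(pullKV Eu w) /Phi standard_form_pull wedge_pull contract_pull_dot //.
move: (pull (invmx E) w) => {}w.
split=> [/pull_eq0 w0 d|d0].
  apply: (pull0 1%N) => I; case: (tupleP I) => x I'; rewrite (tuple0 I').
  have := wedge_standard_form_eps w x; rewrite big1 => [|A _]; last first.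
    by rewrite w0 mul0r.
  move=> /esym/eqP.
  rewrite mulNr oppr_eq0 !mulf_eq0 invr_eq0 !pnatr_eq0.
  by rewrite !eqn0Ngt !fact_gt0 /= => /eqP.
apply: pull0; apply: (@alternating_eps_eq0 R 7).
  exact: (@wedge_alternating R 8 3 4).
move=> d; rewrite wedge_standard_form_eps (pull_eq0 1%N) ?mulr0 // => I.
by case: (tupleP I) => x I'; rewrite (tuple0 I').
Qed.

End Pointwise.

(** * Smooth fields obtained by contraction, linear combination and change of sign *)

Section Fields.
Variables (R : realType) (n : nat) (M : manifold R n).

(** A nonzero kernel vector would have length zero. *)
Lemma metric_unitmx (g : metric M) c p : atlas c -> dom c p ->
  gram (g c p) \in unitmx.
Proof.
move=> ac dp; rewrite -row_free_unit -kermx_eq0.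
apply: contraT => /rowV0Pn[v /sub_kermxP vG v0].
by have := metric_posdef g ac dp v0; rewrite vG mul0mx mxE ltxx.
Qed.

Lemma gram_pull (J : 'M[R]_n) (t : comps R n 2) :
  gram (pull J t) = J^T *m gram t *m J.
Proof.
apply/matrixP => i j; rewrite !mxE /pull !sum_tuple_cons.
under [RHS]eq_bigr => y _ do rewrite mxE big_distrl.
rewrite [RHS]exchange_big; apply: eq_bigr => x _ /=.
rewrite sum_tuple1; apply: eq_bigr => y _.
rewrite !big_ord_recl big_ord0 mulr1 !mxE mulrA [t _ * _]mulrC.
by congr (_ * _ * _).
Qed.

Lemma tcomp_pull k (t : tensor_field M k) c c' p :
  atlas c -> atlas c' -> dom c p -> dom c' p ->
  t c p = pull (jac c c' p) (t c' p).
Proof. by move=> *; apply/funext => I; exact: tcomp_transf. Qed.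

(** With [J] the Jacobian, the Gram matrix in [c] is [J^T G' J], so its invertibility forces that of
    [J]. *)
Lemma jac_unitmx (g : metric M) (c c' : chart R n M) p :
  atlas c -> atlas c' -> dom c p -> dom c' p -> jac c c' p \in unitmx.
Proof.
move=> ac ac' dp dp'; have := metric_unitmx g ac dp.
by rewrite (tcomp_pull _ ac ac' dp dp') gram_pull !unitmx_mul => /andP[].
Qed.

Section Contraction.
Variables (g : metric M) (k m : nat) (a : form M k) (b : form M (k + m)).

Let cont (c : chart R n M) (p : M) : comps R n m :=
  contract (gram (g c p)) (a c p) (b c p).

Lemma contract_smooth (c : chart R n M) : atlas c -> forall I : m.-tuple 'I_n,
  smooth_on (coord c @` dom c) (fun x => cont c (param c x) I).
Proof.
move=> ac I; have Uo := @img_open _ _ _ c.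
apply: smooth_on_sum => // A; apply: smooth_on_sum => // B.
apply: smooth_onM => //; last exact: tcomp_smooth.
apply: smooth_onM => //; first exact: tcomp_smooth.
apply: smooth_on_prod => // r; apply: smooth_on_invmx => //.
  by move=> _ [q dq <-]; rewrite coordK //; exact: metric_unitmx.
move=> i j; apply: (eq_smooth_on Uo _ (tcomp_smooth g ac [tuple i; j])).
by move=> x _; rewrite mxE.
Qed.

Lemma contract_transf (c c' : chart R n M) p :
  atlas c -> atlas c' -> dom c p -> dom c' p ->
  forall I : m.-tuple 'I_n,
  cont c p I = \sum_(A : m.-tuple 'I_n) cont c' p A *
                  \prod_(r < m) jac c c' p (tnth A r) (tnth I r).
Proof.
move=> ac ac' dp dp' I; rewrite /cont !(tcomp_pull _ ac ac' dp dp') gram_pull.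
by rewrite contract_pull ?(jac_unitmx g) // metric_unitmx.
Qed.

Definition contract_form : form M m :=
  @Form R n M m (TensorField contract_smooth contract_transf)
    (fun c p ac dp => contract_alternating _ _ (form_alt b ac dp)).

End Contraction.

Section Combination.
Variables (k : nat) (x y : R) (u v : form M k).

Let comb (c : chart R n M) (p : M) : comps R n k :=
  fun I => x * u c p I + y * v c p I.

Lemma combine_smooth (c : chart R n M) : atlas c -> forall I : k.-tuple 'I_n,
  smooth_on (coord c @` dom c) (fun z => comb c (param c z) I).
Proof.
move=> ac I; have Uo := @img_open _ _ _ c.
by apply: smooth_onD => //; apply: smooth_onZ => //; exact: tcomp_smooth.
Qed.

Lemma combine_transf (c c' : chart R n M) p :
  atlas c -> atlas c' -> dom c p -> dom c' p ->
  forall I : k.-tuple 'I_n,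
  comb c p I = \sum_(A : k.-tuple 'I_n) comb c' p A *
                  \prod_(r < k) jac c c' p (tnth A r) (tnth I r).
Proof.
move=> ac ac' dp dp' I; rewrite /comb !(tcomp_pull _ ac ac' dp dp').
by rewrite -/(pull _ _ I) pullD.
Qed.

Definition combine_form : form M k :=
  @Form R n M k (TensorField combine_smooth combine_transf)
    (fun c p ac dp =>
      alternating_linear x y (form_alt u ac dp) (form_alt v ac dp)).

End Combination.

Section Opposite.
Variable X : vector_field M.

Lemma opp_smooth (c : chart R n M) : atlas c -> forall i : 'I_n,
  smooth_on (coord c @` dom c) (fun z => - X c (param c z) i).
Proof.
move=> ac i; have Uo := @img_open _ _ _ c.
apply: (eq_smooth_on Uo _ (smooth_onZ (-1) Uo (vcomp_smooth X ac i))).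
by move=> z _; rewrite mulN1r.
Qed.

Lemma opp_transf (c c' : chart R n M) p :
  atlas c -> atlas c' -> dom c p -> dom c' p ->
  forall a, - X c' p a = \sum_(i < n) jac c c' p a i * - X c p i.
Proof.
move=> ac ac' dp dp' a; rewrite (vcomp_transf X ac ac' dp dp') -sumrN.
by apply: eq_bigr => i _; rewrite mulrN.
Qed.

(** Converts between inserting a vector in the first and in the last slot of a 4-form, which differ
    by a sign. *)
Definition opp_vector_field : vector_field M :=
  @VectorField R n M (fun c p i => - X c p i) opp_smooth opp_transf.

End Opposite.

End Fields.

(** Three adjacent transpositions carry [l] from the first slot to the last. *)
Lemma alternating_rot4 (R : realType) n (a : comps R n 4) i j k l :
  alternating a -> a [tuple l; i; j; k] = - a [tuple i; j; k; l].
Proof.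
move=> aa; have swap (x y : 'I_4) (I J : 4.-tuple 'I_n) : x != y ->
    permute (tperm x y) I = J -> a J = - a I.
  by move=> xy <-; rewrite [a _]aa odd_tperm xy expr1 mulN1r.
have tperm4 (x y : 'I_4) (I J : 4.-tuple 'I_n) : tnth J x = tnth I y ->
    tnth J y = tnth I x ->
    (forall z, z != x -> z != y -> tnth J z = tnth I z) ->
    permute (tperm x y) I = J.
  move=> xy yx zz; apply: eq_from_tnth => z; rewrite tnth_permute.
  by case: tpermP => [->|->|/eqP zx /eqP zy]; rewrite ?xy ?yx ?zz.
have step x y I J : x != y -> tnth J x = tnth I y -> tnth J y = tnth I x ->
    (forall z, z != x -> z != y -> tnth J z = tnth I z) -> a J = - a I.
  by move=> xy *; apply: (swap x y) => //; exact: tperm4.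
pose o1 : 'I_4 := Ordinal (isT : 1 < 4)%N.
pose o2 : 'I_4 := Ordinal (isT : 2 < 4)%N.
rewrite (step ord0 o1 [tuple i; l; j; k]) //; last by case=> [[|[|[|[|]]]]].
rewrite (step o1 o2 [tuple i; j; l; k]) //; last by case=> [[|[|[|[|]]]]].
rewrite (step o2 ord_max [tuple i; j; k; l]) ?opprK //.
by case=> [[|[|[|[|]]]]].
Qed.

Lemma tuple2E (T : Type) (I : 2.-tuple T) : exists i j, I = [tuple i; j].
Proof.
case: (tupleP I) => i I1; case: (tupleP I1) => j I2; exists i, j.
by rewrite (tuple0 I2); apply: val_inj.
Qed.

Lemma tuple3E (T : Type) (I : 3.-tuple T) : exists i j k, I = [tuple i; j; k].
Proof.
case: (tupleP I) => i I1; case: (tuple2E I1) => j [k ->]; exists i, j, k.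
exact: val_inj.
Qed.

(** * Characterizations of the summands, and the projections *)

Section Spin7.
Variables (R : realType) (M : manifold R 8).
Variables (Phi : form M 4) (g : metric M) (o : orientation M).
Hypothesis PhiSpin7 : Spin7_structure Phi.
Hypothesis g_Phi : associated_metric Phi g.
Hypothesis o_Phi : associated_orientation Phi o.

Lemma contract2E (b : form M 2) c p i j : contract2 Phi g b c p i j =
  contract (m := 2) (gram (g c p)) (b c p) (Phi c p) [tuple i; j].
Proof.
rewrite /contract2 /contract !sum_tuple_cons; apply: eq_bigr => a _.
rewrite sum_tuple1; apply: eq_bigr => a' _.
rewrite !sum_tuple_cons; apply: eq_bigr => q _.
rewrite sum_tuple1; apply: eq_bigr => q' _.
rewrite !big_ord_recl big_ord0 mulr1 mulrA.
by congr (b c p _ * _ * _ * Phi c p _); apply: val_inj.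
Qed.

Lemma contract3E (w : form M 3) c p d : contract3 Phi g w c p d =
  contract (m := 1) (gram (g c p)) (w c p) (Phi c p) [tuple d].
Proof.
rewrite /contract3 /contract !sum_tuple_cons; apply: eq_bigr => i _.
rewrite sum_tuple_cons; apply: eq_bigr => j _.
rewrite sum_tuple1; apply: eq_bigr => k _.
rewrite !sum_tuple_cons; apply: eq_bigr => x _.
rewrite sum_tuple_cons; apply: eq_bigr => y _.
rewrite sum_tuple1; apply: eq_bigr => z _.
rewrite !big_ord_recl big_ord0 mulr1 !mulrA.
by congr (w c p _ * _ * _ * _ * Phi c p _); apply: val_inj.
Qed.

(** In an adapted coframe at [p] the metric is [E^T E] and [Phi] is the standard form, so the
    pointwise identity applies. *)
Lemma star_Phi_wedgeE (b : form M 2) c p : atlas c -> dom c p -> forall i j,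
  star_Phi_wedge Phi g o b c p [tuple i; j] = 2^-1 * contract2 Phi g b c p i j.
Proof.
move=> ac dp i j; have [E EPhi] := PhiSpin7 ac dp.
rewrite contract2E /star_Phi_wedge (g_Phi ac dp EPhi).
have -> : Phi c p = standard_form E by apply/funext; case: EPhi.
rewrite hodge_wedge_contract //; first by case: EPhi.
- exact: osign_pm1.
- exact: (o_Phi ac dp EPhi).
Qed.

Lemma contract2_square (b : form M 2) c p : atlas c -> dom c p -> forall I,
  contract (m := 2) (gram (g c p))
    (contract (m := 2) (gram (g c p)) (b c p) (Phi c p)) (Phi c p) I =
  - 4 * contract (m := 2) (gram (g c p)) (b c p) (Phi c p) I + 12 * b c p I.
Proof.
move=> ac dp I; have [E EPhi] := PhiSpin7 ac dp.
rewrite (g_Phi ac dp EPhi).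
have -> : Phi c p = standard_form E by apply/funext; case: EPhi.
rewrite contract_square //; [by case: EPhi|exact: form_alt].
Qed.

Lemma contract_linear k m (G : 'M[R]_8) (a b : comps R 8 k)
    (e : comps R 8 (k + m)) x y :
  contract G (fun I => x * a I + y * b I) e =
  (fun J => x * contract G a e J + y * contract G b e J).
Proof.
apply/funext => J; rewrite /contract !big_distrr -big_split /=.
apply: eq_bigr => I _; rewrite !big_distrr -big_split /=.
by apply: eq_bigr => A _; rewrite !mulrDl !mulrA.
Qed.

(** The star operator is half the contraction, so its eigenvalue -3 becomes -6; likewise 1 becomes 2
    in the next lemma. *)
Lemma Omega2_7E (b : form M 2) : Omega2_7 Phi g o b <->
  in_coords (fun c p => forall i j : 'I_8,
    contract2 Phi g b c p i j = - 6 * b c p [tuple i; j]).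
Proof.
split=> [h c p ac dp i j|h c p ac dp I].
  have := h c p ac dp [tuple i; j]; rewrite star_Phi_wedgeE //.
  by move: (contract2 _ _ _ _ _ _ _) (b _ _ _) => x y xy; lra.
have [i [j ->]] := tuple2E I; rewrite star_Phi_wedgeE // (h c p ac dp).
by move: (b _ _ _) => x; lra.
Qed.

Lemma Omega2_21E (b : form M 2) : Omega2_21 Phi g o b <->
  in_coords (fun c p => forall i j : 'I_8,
    contract2 Phi g b c p i j = 2 * b c p [tuple i; j]).
Proof.
split=> [h c p ac dp i j|h c p ac dp I].
  have := h c p ac dp [tuple i; j]; rewrite star_Phi_wedgeE //.
  by move: (contract2 _ _ _ _ _ _ _) (b _ _ _) => x y xy; lra.
have [i [j ->]] := tuple2E I; rewrite star_Phi_wedgeE // (h c p ac dp).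
by move: (b _ _ _) => x; lra.
Qed.

Lemma Omega3_8E (w : form M 3) : Omega3_8 Phi w <->
  exists X : vector_field M, in_coords (fun c p => forall i j k : 'I_8,
    w c p [tuple i; j; k] = \sum_(l < 8) X c p l * Phi c p [tuple i; j; k; l]).
Proof.
have rot c p (ac : atlas c) (dp : dom c p) i j k l :
    Phi c p [tuple of l :: [tuple i; j; k]] = - Phi c p [tuple i; j; k; l].
  rewrite -(alternating_rot4 _ _ _ _ (form_alt Phi ac dp)).
  by congr (Phi c p _); apply: val_inj.
split=> -[X wX]; exists (opp_vector_field X) => c p ac dp.
  move=> i j k; rewrite wX //; apply: eq_bigr => l _ /=.
  by rewrite rot // mulrN mulNr.
move=> I; have [i [j [k ->]]] := tuple3E I.
rewrite wX //; apply: eq_bigr => l _ /=.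
by rewrite [in RHS]rot // mulrNN.
Qed.

Lemma Omega3_48E (w : form M 3) : Omega3_48 Phi w <->
  in_coords (fun c p => forall d : 'I_8, contract3 Phi g w c p d = 0).
Proof.
have key c p (ac : atlas c) (dp : dom c p) :
    (forall I, wedge (w c p) (Phi c p) I = 0) <->
    (forall d, contract3 Phi g w c p d = 0).
  have [E EPhi] := PhiSpin7 ac dp.
  under [X in _ <-> X]eq_forall => d do
    rewrite contract3E (g_Phi ac dp EPhi).
  have -> : Phi c p = standard_form E by apply/funext; case: EPhi.
  by apply: wedge_eq0_contract; case: EPhi.
by split=> h c p ac dp; apply/(key c p ac dp); exact: h.
Qed.

(** With [K] the contraction, this is the spectral projection [(2 - K) / 8] for the eigenvalue -6;
    [pi21] is [(K + 6) / 8], for the eigenvalue 2. *)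
Definition pi7 (b : form M 2) : form M 2 :=
  combine_form 4^-1 (- 8^-1) b (contract_form (m := 2) g b Phi).

Definition pi21 (b : form M 2) : form M 2 :=
  combine_form (3 / 4) 8^-1 b (contract_form (m := 2) g b Phi).

Lemma pi_projections : decomposition_projections
  (Omega2_7 Phi g o) (Omega2_21 Phi g o) pi7 pi21.
Proof.
move=> b; split.
- apply/Omega2_7E => c p ac dp i j; rewrite contract2E /= contract_linear.
  (* Applying [K] to the projection produces [K^2 b], which the quadratic relation replaces by
     [- 4 K b + 12 b]. *)
  rewrite contract2_square //.
  by move: (contract _ _ _ _) (b _ _ _) => x y; field.
- apply/Omega2_21E => c p ac dp i j; rewrite contract2E /= contract_linear.
  rewrite contract2_square //.
  by move: (contract _ _ _ _) (b _ _ _) => x y; field.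
- move=> c p ac dp I /=.
  by move: (contract _ _ _ _) (b _ _ _) => x y; field.
(* Uniqueness: [b = u + v] and [K b = - 6 u + 2 v] determine [u] and [v] from [b] and [K b]. *)
move=> u v /Omega2_7E u7 /Omega2_21E v21 buv.
have cb c p (ac : atlas c) (dp : dom c p) i j :
    contract (m := 2) (gram (g c p)) (b c p) (Phi c p) [tuple i; j] =
    - 6 * u c p [tuple i; j] + 2 * v c p [tuple i; j].
  rewrite -u7 // -v21 // !contract2E.
  have -> : b c p = (fun I => 1 * u c p I + 1 * v c p I).
    by apply/funext => I; rewrite !mul1r buv.
  by rewrite contract_linear !mul1r.
split=> c p ac dp I; have [i [j ->]] := tuple2E I; rewrite /= cb // buv //;
  by move: (u _ _ _) (v _ _ _) => x y; field.
Qed.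

End Spin7.

Theorem proposition2p1 (R : realType) (M : manifold R 8) (Phi : form M 4)
    (g : metric M) (o : orientation M)
    (PhiSpin7 : Spin7_structure Phi)
    (g_Phi : associated_metric Phi g)
    (o_Phi : associated_orientation Phi o) :
  (forall beta : form M 2,
     (Omega2_7 Phi g o beta <->
      in_coords (fun c p => forall i j : 'I_8,
        contract2 Phi g beta c p i j = - 6 * beta c p [tuple i; j])) /\
     (Omega2_21 Phi g o beta <->
      in_coords (fun c p => forall i j : 'I_8,
        contract2 Phi g beta c p i j = 2 * beta c p [tuple i; j]))) /\
  (forall gamma : form M 3,
     (Omega3_8 Phi gamma <->
      exists X : vector_field M,
        in_coords (fun c p => forall i j k : 'I_8,
          gamma c p [tuple i; j; k] =
            \sum_(l < 8) X c p l * Phi c p [tuple i; j; k; l])) /\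
     (Omega3_48 Phi gamma <->
      in_coords (fun c p => forall d : 'I_8,
        contract3 Phi g gamma c p d = 0))) /\
  (exists pi7 pi21 : form M 2 -> form M 2,
     decomposition_projections (Omega2_7 Phi g o) (Omega2_21 Phi g o)
       pi7 pi21 /\
     forall beta : form M 2, in_coords (fun c p => forall i j : 'I_8,
       pi7 beta c p [tuple i; j] =
         4^-1 * beta c p [tuple i; j] - 8^-1 * contract2 Phi g beta c p i j /\
       pi21 beta c p [tuple i; j] =
         3 / 4 * beta c p [tuple i; j]
         + 8^-1 * contract2 Phi g beta c p i j)).
Proof.
split; first by move=> b; split; [exact: Omega2_7E|exact: Omega2_21E].
split; first by move=> w; split; [exact: Omega3_8E|exact: Omega3_48E].
exists (pi7 Phi g), (pi21 Phi g); split; first exact: pi_projections.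
by move=> b c p ac dp i j; rewrite !contract2E /= mulNr.
Qed.
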